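(* A partial groupoid $X$ is embeddable if and only if it is orthogonal (in the category of partial groupoids) to the set of maps $$\left\{\mathrm{NA}^{T,T'}\to \mathrm{A}^{T,T'}\ \middle|\ T,T'\text{ well-behaved}\right\},$$ where $T,T'$ range over all well-behaved pairs of triangulations of regular $(n+1)$-gons, for all $n$.
   Context: Let $\Upsilon$ be the category whose objects are the sets $[n]=\{0,1,\dots,n\}$, $n\ge 0$, with arbitrary functions as morphisms. A symmetric set is a functor $X\colon \Upsilon^{\mathrm{op}}\to \mathsf{Set}$, with $X_n=X([n])$; maps are natural transformations. The Segal map sends $x\in X_n$ to the word of its principal edges (restrictions to $\{i-1,i\}$, $1\le i\le n$) in $X_1\times_{X_0}\cdots\times_{X_0}X_1$. $X$ is spiny if the Segal map is injective for all $n\ge1$. A partial groupoid is a spiny symmetric set. $N\colon\mathsf{Gpd}\to\mathsf{Sym}$ is the nerve functor, where $(NG)_n$ is the set of functors to $G$ from the groupoid with object set $[n]$ and exactly one morphism between any two objects; $\tau$ is its left adjoint. A partial groupoid $X$ is embeddable if the unit map $X\to N\tau X$ is a monomorphism. $\Upsilon^n=\hom_\Upsilon(-,[n])$ is the representable symmetric set. The spine $\mathrm{Sp}^n\subseteq\Upsilon^n$ consists of those functions $[m]\to[n]$ whose image lies in $\{i,i+1\}$ for some $i$; the circular spine $\mathrm{cSp}^n$ consists of those whose image lies in $\{i,i+1\}$ for some $i$ or in $\{0,n\}$. The vertices of the regular $(n+1)$-gon ($n\ge2$) are labelled $0,1,\dots,n$ in cyclic order. A triangulation $T$ (using only the vertices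 of the polygon) is regarded as the set of its triangles. $H(T)\subseteq\Upsilon^n$ is the symmetric subset of those functions $[m]\to[n]$ whose image is contained in the vertex set of some triangle of $T$; it contains $\mathrm{Sp}^n$ and $\mathrm{cSp}^n$. The pair $T,T'$ is well-behaved if the pushout of symmetric sets $\mathrm{A}^{T,T'}:=H(T)\amalg_{\mathrm{cSp}^n}H(T')$ is spiny. In that case $\mathrm{NA}^{T,T'}:=H(T)\amalg_{\mathrm{Sp}^n}H(T')$ is spiny too, and $\mathrm{NA}^{T,T'}\to\mathrm{A}^{T,T'}$ is the canonical map of pushouts induced by $\mathrm{Sp}^n\subseteq\mathrm{cSp}^n$. In a category $C$, an object $x$ is orthogonal to a map $f\colon a\to b$ if for each map $g\colon a\to x$ there is a unique map $h\colon b\to x$ with $g=hf$; it is orthogonal to a set of maps if it is orthogonal to each of them. *)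

(* Defs.v *)
From HB Require Import structures.
From mathcomp Require Import all_boot boolp zify.
From Stdlib Require Import Relation_Operators.

Set Implicit Arguments.
Unset Strict Implicit.
Unset Printing Implicit Defensive.

Local Open Scope quotient_scope.

(** * Quotient of a type by the equivalence relation generated by [R] *)

Section Quotient.
Variables (T : Type) (R : T -> T -> Prop).

Definition quot_rel (x y : {classic T}) : bool := `[< clos_refl_sym_trans T R x y >].

Lemma quot_rel_refl : reflexive quot_rel.
Proof. by move=> x; apply/asboolP; apply: rst_refl. Qed.

Lemma quot_rel_sym : symmetric quot_rel.
Proof. by move=> x y; apply/asboolP/asboolP => h; apply: rst_sym. Qed.

Lemma quot_rel_trans : transitive quot_rel.
Proof.
move=> y x z /asboolP h /asboolP k; apply/asboolP; exact: rst_trans h k.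
Qed.

Canonical quot_equiv := EquivRel quot_rel quot_rel_refl quot_rel_sym quot_rel_trans.

Definition quot : Type := {eq_quot quot_equiv}.

Definition class (x : T) : quot := \pi_({eq_quot quot_equiv}) (x : {classic T}).

Definition rep (q : quot) : T := repr (q : {eq_quot quot_equiv}).

Lemma repK q : class (rep q) = q.
Proof. exact: reprK. Qed.

Lemma classE x y : class x = class y <-> clos_refl_sym_trans T R x y.
Proof.
split=> [/(@eqmodP _ quot_equiv x y) /asboolP // | h].
by apply/(@eqmodP _ quot_equiv x y)/asboolP.
Qed.

Lemma class_eq x y : R x y -> class x = class y.
Proof. by move=> h; apply/classE; apply: rst_step. Qed.

Definition quot_lift (U : Type) (f : T -> U) (q : quot) : U := f (rep q).

Lemma quot_liftE (U : Type) (f : T -> U) :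
  (forall x y, R x y -> f x = f y) -> forall x, quot_lift f (class x) = f x.
Proof.
move=> fR x; rewrite /quot_lift.
have /classE h : class (rep (class x)) = class x by rewrite repK.
by move: (rep _) h => y; elim=> [a b /fR | | a b _ -> | a b c _ -> _ ->].
Qed.

End Quotient.

(** * Symmetric sets *)

Record symset := SymSet {
  cells :> nat -> Type;
  act : forall m n : nat, ('I_m.+1 -> 'I_n.+1) -> cells n -> cells m;
  act_id : forall n (x : cells n), act (fun i => i) x = x;
  act_comp : forall l m n (a : 'I_l.+1 -> 'I_m.+1) (b : 'I_m.+1 -> 'I_n.+1)
    (x : cells n), act (fun i => b (a i)) x = act a (act b x)
}.
Arguments act {s m n} a x.

Record hom (X Y : symset) := Hom {
  happ :> forall n, X n -> Y n;
  hnat : forall m n (a : 'I_m.+1 -> 'I_n.+1) (x : X n),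
    happ (act a x) = act a (happ x)
}.
Arguments happ {X Y} h {n} x.

Lemma hom_ext (X Y : symset) (f g : hom X Y) :
  (forall n (x : X n), f n x = g n x) -> f = g.
Proof.
case: f g => [f fn] [g gn] /= fg.
have e : f = g by apply: functional_extensionality_dep => n; apply/funext.
by subst g; congr Hom.
Qed.

Definition hcomp (X Y Z : symset) (g : hom Y Z) (f : hom X Y) : hom X Z.
Proof.
exists (fun n x => happ g (happ f x)) => m n a x; by rewrite !hnat.
Defined.

Definition monomorphism (X Y : symset) (f : hom X Y) : Prop :=
  forall (Z : symset) (g h : hom Z X), hcomp f g = hcomp f h -> g = h.

(** * Partial groupoids *)

Definition pair_map n (i j : 'I_n.+1) : 'I_2 -> 'I_n.+1 :=
  fun k => if k == ord0 then i else j.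

Definition vertex (X : symset) n (i : 'I_n.+1) (x : X n) : X 0 :=
  act (fun _ : 'I_1 => i) x.

Definition edge (X : symset) n (i j : 'I_n.+1) (x : X n) : X 1 :=
  act (pair_map i j) x.

(* For [i : 'I_n], [widen_ord (leqnSn n) i] and [lift ord0 i] are [i] and [i + 1]
   in ['I_n.+1].  The iterated fibre product of copies of [X 1] is a subset of
   the set of all words ['I_n -> X 1]. *)
Definition segal (X : symset) n (x : X n) : 'I_n -> X 1 :=
  fun i => edge (widen_ord (leqnSn n) i) (lift ord0 i) x.

Definition spiny (X : symset) : Prop :=
  forall n, 1 <= n -> injective (@segal X n).

(* Partial groupoids form a full subcategory of symmetric sets, so their maps
   are the elements of [hom]. *)
Record partial_groupoid := PartialGroupoid {
  pg_symset :> symset;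
  pg_spiny : spiny pg_symset
}.

Definition orthogonal (X A B : partial_groupoid) (f : hom A B) : Prop :=
  forall g : hom A X, exists! h : hom B X, g = hcomp h f.

(** * Groupoids, the nerve and its left adjoint *)

Record groupoid := Groupoid {
  gob :> Type;
  ghom : gob -> gob -> Type;
  gid : forall x, ghom x x;
  gcomp : forall x y z, ghom x y -> ghom y z -> ghom x z;
  ginv : forall x y, ghom x y -> ghom y x;
  gidl : forall x y (f : ghom x y), gcomp (gid x) f = f;
  gidr : forall x y (f : ghom x y), gcomp f (gid y) = f;
  gassoc : forall x y z t (f : ghom x y) (g : ghom y z) (h : ghom z t),
    gcomp f (gcomp g h) = gcomp (gcomp f g) h;
  ginvr : forall x y (f : ghom x y), gcomp f (ginv f) = gid x;
  ginvl : forall x y (f : ghom x y), gcomp (ginv f) f = gid y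
}.
Arguments ghom {G} x y : rename.
Arguments gid {G} x : rename.
Arguments gcomp {G x y z} f g : rename.
Arguments ginv {G x y} f : rename.

Record gfunctor (C D : groupoid) := GFunctor {
  fob :> C -> D;
  fmor : forall x y, ghom x y -> ghom (fob x) (fob y);
  fmor_id : forall x, fmor (gid x) = gid (fob x);
  fmor_comp : forall x y z (f : ghom x y) (g : ghom y z),
    fmor (gcomp f g) = gcomp (fmor f) (fmor g)
}.
Arguments fmor {C D} F {x y} f : rename.

Definition gfcomp (C D E : groupoid) (G : gfunctor D E) (F : gfunctor C D) :
  gfunctor C E.
Proof.
exists (fun x => G (F x)) (fun x y f => fmor G (fmor F f)).
- by move=> x; rewrite !fmor_id.
- by move=> x y z f g; rewrite !fmor_comp.
Defined.

(* An arrow bundled with its endpoints, to compare arrows whose endpoints are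
   equal but not convertible. *)
Definition arr (G : groupoid) (x y : G) (f : ghom x y) : {p : G * G & ghom p.1 p.2} :=
  existT (fun p : G * G => ghom p.1 p.2) (x, y) f.

Lemma arr_inj (G : groupoid) (x y : G) (f g : ghom x y) : arr f = arr g -> f = g.
Proof.
move=> fg; have := projT2_eq fg.
by rewrite (Prop_irrelevance (projT1_eq fg) erefl).
Qed.

Lemma arr_comp (G : groupoid) (x y z x' y' z' : G) (f : ghom x y) (g : ghom y z)
    (f' : ghom x' y') (g' : ghom y' z') :
  arr f = arr f' -> arr g = arr g' -> arr (gcomp f g) = arr (gcomp f' g').
Proof.
move=> ef eg.
have [ex ey] : (x, y) = (x', y') by exact: (f_equal (@projT1 _ _) ef).
have [_ ez] : (y, z) = (y', z') by exact: (f_equal (@projT1 _ _) eg).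
subst x' y' z'.
by rewrite (arr_inj ef) (arr_inj eg).
Qed.

Lemma arr_inv (G : groupoid) (x y x' y' : G) (f : ghom x y) (f' : ghom x' y') :
  arr f = arr f' -> arr (ginv f) = arr (ginv f').
Proof.
move=> ef.
have [ex ey] : (x, y) = (x', y') by exact: (f_equal (@projT1 _ _) ef).
subst x' y'.
by rewrite (arr_inj ef).
Qed.

Lemma arr_fmor (C D : groupoid) (F : gfunctor C D) (x y x' y' : C)
    (f : ghom x y) (f' : ghom x' y') :
  arr f = arr f' -> arr (fmor F f) = arr (fmor F f').
Proof.
move=> ef.
have [ex ey] : (x, y) = (x', y') by exact: (f_equal (@projT1 _ _) ef).
subst x' y'.
by rewrite (arr_inj ef).
Qed.

Lemma ginv_unique (G : groupoid) (x y : G) (f : ghom x y) (g : ghom y x) :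
  gcomp f g = gid x -> g = ginv f.
Proof. by move=> fg; rewrite -[g]gidl -(ginvl f) -gassoc fg gidr. Qed.

Lemma gid_idem (G : groupoid) (x : G) (f : ghom x x) : gcomp f f = f -> f = gid x.
Proof. by move=> ff; rewrite -[LHS]gidr -(ginvr f) gassoc ff. Qed.

Lemma fmor_inv (C D : groupoid) (F : gfunctor C D) (x y : C) (f : ghom x y) :
  fmor F (ginv f) = ginv (fmor F f).
Proof. by apply: ginv_unique; rewrite -fmor_comp ginvr fmor_id. Qed.

Lemma gfunctor_ext (C D : groupoid) (F G : gfunctor C D) :
  (forall x y (f : ghom x y), arr (fmor F f) = arr (fmor G f)) -> F = G.
Proof.
case: F G => [F0 F1 Fi Fc] [G0 G1 Gi Gc] /= FG.
have e : F0 = G0.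
  apply/funext => x.
  by have [] := f_equal (fun a => (projT1 a).1) (FG x x (gid x)).
subst G0.
have e : F1 = G1.
  apply: functional_extensionality_dep => x.
  apply: functional_extensionality_dep => y.
  apply/funext => f; exact: arr_inj (FG x y f).
by subst G1; congr GFunctor.
Qed.

Lemma gfunctor_congr (C D : groupoid) (F G : gfunctor C D) x y (f : ghom x y) :
  F = G -> arr (fmor F f) = arr (fmor G f).
Proof. by move=> ->. Qed.

(* The groupoid with object set [I] and exactly one morphism between any two
   objects. *)
Definition chaotic (I : Type) : groupoid.
Proof.
by exists I (fun _ _ => unit) (fun _ => tt) (fun _ _ _ _ _ => tt) (fun _ _ _ => tt);
  [move=> x y [] | move=> x y [] | | |].
Defined.

Definition chaotic_map (I J : Type) (a : I -> J) : gfunctor (chaotic I) (chaotic J).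
Proof. by exists (a : chaotic I -> chaotic J) (fun _ _ _ => tt). Defined.

Definition nerve (G : groupoid) : symset.
Proof.
exists (fun n => gfunctor (chaotic 'I_n.+1) G)
       (fun m n a x => gfcomp x (chaotic_map a)).
- by move=> n x; apply: gfunctor_ext => i j [].
- by move=> l m n a b x; apply: gfunctor_ext => i j [].
Defined.

Definition nerve_map (G H : groupoid) (F : gfunctor G H) : hom (nerve G) (nerve H).
Proof.
exists (fun n (x : nerve G n) => gfcomp F x : nerve H n) => m n a x.
by apply: gfunctor_ext => i j [].
Defined.

Section Tau.
Variable X : symset.

Local Notation src e := (vertex (@ord0 1) e).
Local Notation tgt e := (vertex (@ord_max 1) e).

Lemma vertex_act m n (a : 'I_m.+1 -> 'I_n.+1) (i : 'I_m.+1) (x : X n) :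
  vertex i (act a x) = vertex (a i) x.
Proof. by rewrite /vertex -act_comp. Qed.

Lemma edge_act m n (a : 'I_m.+1 -> 'I_n.+1) (i j : 'I_m.+1) (x : X n) :
  edge i j (act a x) = edge (a i) (a j) x.
Proof.
rewrite /edge -act_comp; congr (act _ x); apply/funext => k.
by rewrite /pair_map; case: ifP.
Qed.

Lemma vertex_point (x : X 0) : vertex ord0 x = x.
Proof.
rewrite -[RHS]act_id; congr (act _ x); apply/funext => k; exact/esym/ord1.
Qed.

Lemma edge_full (e : X 1) : edge ord0 ord_max e = e.
Proof.
rewrite -[RHS]act_id; congr (act _ e); apply/funext => k; apply/val_inj.
by rewrite /pair_map; case: k => [] [|[|]].
Qed.

Lemma src_edge n (i j : 'I_n.+1) (x : X n) : src (edge i j x) = vertex i x.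
Proof. exact: vertex_act. Qed.

Lemma tgt_edge n (i j : 'I_n.+1) (x : X n) : tgt (edge i j x) = vertex j x.
Proof. exact: vertex_act. Qed.

(* [tau X] has [X 0] as its set of objects; it is generated by the elements of
   [X 1], and each element of [X 2] gives one relation. *)
Inductive gexp : X 0 -> X 0 -> Type :=
| egen x y (e : X 1) : src e = x -> tgt e = y -> gexp x y
| eid x : gexp x x
| ecomp x y z : gexp x y -> gexp y z -> gexp x z
| einv x y : gexp x y -> gexp y x.

Inductive grel : forall x y, gexp x y -> gexp x y -> Prop :=
| grel_tri (s : X 2) (v0 v1 v2 : 'I_3) x y z
    (p01 : src (edge v0 v1 s) = x) (q01 : tgt (edge v0 v1 s) = y)
    (p12 : src (edge v1 v2 s) = y) (q12 : tgt (edge v1 v2 s) = z)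
    (p02 : src (edge v0 v2 s) = x) (q02 : tgt (edge v0 v2 s) = z) :
    v0 = 0 :> nat -> v1 = 1 :> nat -> v2 = 2 :> nat ->
    grel (ecomp (egen p01 q01) (egen p12 q12)) (egen p02 q02)
| grel_idl x y (f : gexp x y) : grel (ecomp (eid x) f) f
| grel_idr x y (f : gexp x y) : grel (ecomp f (eid y)) f
| grel_assoc x y z t (f : gexp x y) (g : gexp y z) (h : gexp z t) :
    grel (ecomp f (ecomp g h)) (ecomp (ecomp f g) h)
| grel_invr x y (f : gexp x y) : grel (ecomp f (einv f)) (eid x)
| grel_invl x y (f : gexp x y) : grel (ecomp (einv f) f) (eid y)
| grel_compl x y z (f f' : gexp x y) (g : gexp y z) :
    grel f f' -> grel (ecomp f g) (ecomp f' g)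
| grel_compr x y z (f : gexp x y) (g g' : gexp y z) :
    grel g g' -> grel (ecomp f g) (ecomp f g')
| grel_inv x y (f f' : gexp x y) : grel f f' -> grel (einv f) (einv f').

Definition tau_hom (x y : X 0) : Type := quot (@grel x y).

Definition tau_comp x y z (f : tau_hom x y) (g : tau_hom y z) : tau_hom x z :=
  class (@grel x z) (ecomp (rep f) (rep g)).

Definition tau_inv x y (f : tau_hom x y) : tau_hom y x :=
  class (@grel y x) (einv (rep f)).

Lemma class_ecomp x y z (f : gexp x y) (g : gexp y z) :
  class (@grel x z) (ecomp f g) = tau_comp (class (@grel x y) f) (class (@grel y z) g).
Proof.
have /classE hf : class (@grel x y) f = class (@grel x y) (rep (class (@grel x y) f)).
  by rewrite repK.
have /classE hg : class (@grel y z) g = class (@grel y z) (rep (class (@grel y z) g)).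
  by rewrite repK.
apply/classE; apply: rst_trans (ecomp (rep (class (@grel x y) f)) g) _ _ _.
- elim: hf => {f} [f f' h | f | f f' _ | f f' f'' _ h _ k].
  + by apply: rst_step; apply: grel_compl.
  + exact: rst_refl.
  + exact: rst_sym.
  + exact: rst_trans h k.
- elim: hg => {g} [g g' h | g | g g' _ | g g' g'' _ h _ k].
  + by apply: rst_step; apply: grel_compr.
  + exact: rst_refl.
  + exact: rst_sym.
  + exact: rst_trans h k.
Qed.

Lemma class_einv x y (f : gexp x y) :
  class (@grel y x) (einv f) = tau_inv (class (@grel x y) f).
Proof.
have /classE hf : class (@grel x y) f = class (@grel x y) (rep (class (@grel x y) f)).
  by rewrite repK.
apply/classE; elim: hf => {f} [f f' h | f | f f' _ | f f' f'' _ h _ k].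
- by apply: rst_step; apply: grel_inv.
- exact: rst_refl.
- exact: rst_sym.
- exact: rst_trans h k.
Qed.

Definition tau : groupoid.
Proof.
exists (X 0) tau_hom (fun x => class (@grel x x) (eid x)) tau_comp tau_inv.
- move=> x y f; rewrite -[f in LHS]repK -class_ecomp -[RHS]repK.
  by apply: class_eq; apply: grel_idl.
- move=> x y f; rewrite -[f in LHS]repK -class_ecomp -[RHS]repK.
  by apply: class_eq; apply: grel_idr.
- move=> x y z t f g h.
  rewrite -[f]repK -[g]repK -[h]repK -!class_ecomp.
  by apply: class_eq; apply: grel_assoc.
- move=> x y f; rewrite -[f]repK -class_einv -class_ecomp.
  by apply: class_eq; apply: grel_invr.
- move=> x y f; rewrite -[f]repK -class_einv -class_ecomp.
  by apply: class_eq; apply: grel_invl.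
Defined.

Definition tau_gen x y (e : X 1) (p : src e = x) (q : tgt e = y) : @ghom tau x y :=
  class (@grel x y) (egen p q).

Lemma tau_gen_congr x y (e : X 1) (p : src e = x) (q : tgt e = y)
    x' y' (e' : X 1) (p' : src e' = x') (q' : tgt e' = y') :
  e = e' -> arr (tau_gen p q) = arr (tau_gen p' q').
Proof. by move=> ee; subst. Qed.

Definition tau_edge n (i j : 'I_n.+1) (x : X n) : @ghom tau (vertex i x) (vertex j x) :=
  tau_gen (src_edge i j x) (tgt_edge i j x).

Lemma tau_edge_comp n (i j k : 'I_n.+1) (x : X n) :
  gcomp (tau_edge i j x) (tau_edge j k x) = tau_edge i k x.
Proof.
pose a (v : 'I_3) := if v == 0 :> nat then i else if v == 1 :> nat then j else k.
pose v0 := @Ordinal 3 0 isT; pose v1 := @Ordinal 3 1 isT; pose v2 := @Ordinal 3 2 isT.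
pose s := act a x.
have e01 : edge v0 v1 s = edge i j x by rewrite edge_act.
have e12 : edge v1 v2 s = edge j k x by rewrite edge_act.
have e02 : edge v0 v2 s = edge i k x by rewrite edge_act.
have p01 : src (edge v0 v1 s) = vertex i x by rewrite e01 src_edge.
have q01 : tgt (edge v0 v1 s) = vertex j x by rewrite e01 tgt_edge.
have p12 : src (edge v1 v2 s) = vertex j x by rewrite e12 src_edge.
have q12 : tgt (edge v1 v2 s) = vertex k x by rewrite e12 tgt_edge.
have p02 : src (edge v0 v2 s) = vertex i x by rewrite e02 src_edge.
have q02 : tgt (edge v0 v2 s) = vertex k x by rewrite e02 tgt_edge.
have -> : tau_edge i j x = tau_gen p01 q01 by apply: arr_inj; apply: tau_gen_congr.
have -> : tau_edge j k x = tau_gen p12 q12 by apply: arr_inj; apply: tau_gen_congr.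
have -> : tau_edge i k x = tau_gen p02 q02 by apply: arr_inj; apply: tau_gen_congr.
rewrite /tau_gen /= -class_ecomp; apply: class_eq; exact: grel_tri.
Qed.

Definition unit_cell n (x : X n) : nerve tau n.
Proof.
exists (fun i : chaotic 'I_n.+1 => vertex i x : tau) (fun i j _ => tau_edge i j x).
- by move=> i; apply: gid_idem; rewrite tau_edge_comp.
- by move=> i j k _ _; rewrite tau_edge_comp.
Defined.

Definition unit_map : hom X (nerve tau).
Proof.
exists unit_cell => m n a x; apply: gfunctor_ext => i j f /=.
by apply: tau_gen_congr; rewrite edge_act.
Defined.

Definition cast_hom (G : groupoid) (x y x' y' : G) (p : x = x') (q : y = y')
    (f : ghom x y) : ghom x' y' :=
  eq_rect y (ghom x') (eq_rect x (fun z => ghom z y) f x' p) y' q.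

Lemma arr_cast (G : groupoid) (x y x' y' : G) (p : x = x') (q : y = y')
    (f : ghom x y) : arr (cast_hom p q f) = arr f.
Proof. by subst. Qed.

Section Extension.
Variables (G : groupoid) (f : hom X (nerve G)).

Let f0 (x : X 0) : G := fob (f 0 x) ord0.

Lemma fob_vertex n (i : 'I_n.+1) (x : X n) : fob (f n x) i = f0 (vertex i x).
Proof. by rewrite /f0 /vertex (hnat f). Qed.

Lemma fob_end (e : X 1) (i : 'I_2) x : vertex i e = x -> fob (f 1 e) i = f0 x.
Proof. by move=> <-; rewrite fob_vertex. Qed.

Fixpoint interp x y (w : gexp x y) : ghom (f0 x) (f0 y) :=
  match w in gexp x y return ghom (f0 x) (f0 y) with
  | egen _ _ e p q => cast_hom (fob_end p) (fob_end q)
      (@fmor _ _ (f 1 e) (@ord0 1) (@ord_max 1) tt)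
  | eid x => gid (f0 x)
  | ecomp _ _ _ u v => gcomp (interp u) (interp v)
  | einv _ _ u => ginv (interp u)
  end.

Lemma arr_interp_edge n (s : X n) (i j : 'I_n.+1) x y
    (p : src (edge i j s) = x) (q : tgt (edge i j s) = y) :
  arr (interp (egen p q)) = arr (@fmor _ _ (f n s) i j tt).
Proof.
rewrite /= arr_cast.
by rewrite (gfunctor_congr (F := f 1 (edge i j s)) _ (hnat f (pair_map i j) s)).
Qed.

Lemma interp_rel x y (u v : gexp x y) : grel u v -> interp u = interp v.
Proof.
elim=> {x y u v} /=.
- move=> s v0 v1 v2 x y z p01 q01 p12 q12 p02 q02 _ _ _; apply: arr_inj.
  rewrite -[X in arr X = _]/(gcomp (interp (egen p01 q01)) (interp (egen p12 q12))).
  rewrite (arr_comp (arr_interp_edge p01 q01) (arr_interp_edge p12 q12)).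
  by rewrite (arr_interp_edge p02 q02) -fmor_comp.
- by move=> x y u; rewrite gidl.
- by move=> x y u; rewrite gidr.
- by move=> x y z t u v w; rewrite gassoc.
- by move=> x y u; rewrite ginvr.
- by move=> x y u; rewrite ginvl.
- by move=> x y z u u' v _ ->.
- by move=> x y z u v v' _ ->.
- by move=> x y u u' _ ->.
Qed.

Lemma interp_rep x y (w : gexp x y) : interp (rep (class (@grel x y) w)) = interp w.
Proof. exact: (quot_liftE (@interp_rel x y) w). Qed.

Definition tau_ext : gfunctor tau G.
Proof.
exists (f0 : tau -> G) (fun x y (u : @ghom tau x y) => interp (rep u)).
- by move=> x /=; rewrite interp_rep.
- by move=> x y z u v /=; rewrite interp_rep.
Defined.

Lemma tau_extE : hcomp (nerve_map tau_ext) unit_map = f.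
Proof.
apply: hom_ext => n x; apply: gfunctor_ext => i j [] /=.
by rewrite interp_rep arr_interp_edge.
Qed.

Lemma tau_ext_unique (F : gfunctor tau G) :
  hcomp (nerve_map F) unit_map = f -> F = tau_ext.
Proof.
move=> Ff; apply: gfunctor_ext => x y u /=.
rewrite -[u]repK interp_rep; elim: (rep u) => {x y u} [x y e p q | x | x y z u hu v hv | x y u hu].
- rewrite /= arr_cast.
  have F1 : gfcomp F (unit_cell e) = f 1 e by rewrite -Ff.
  rewrite -(gfunctor_congr _ F1) /=; apply: arr_fmor; apply: tau_gen_congr.
  by rewrite edge_full.
- have F0 : gfcomp F (unit_cell x) = f 0 x by rewrite -Ff.
  have Fx : F x = f0 x by rewrite /f0 -F0 /= vertex_point.
  by rewrite /= (fmor_id F x) Fx.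
- rewrite class_ecomp (fmor_comp F (class (@grel x y) u) (class (@grel y z) v)).
  exact: arr_comp.
- rewrite class_einv (fmor_inv F (class (@grel x y) u)).
  exact: arr_inv.
Qed.

End Extension.
End Tau.

(* [tau] is left adjoint to [nerve], with unit [unit_map]. *)
Lemma unit_map_universal (X : symset) (G : groupoid) (f : hom X (nerve G)) :
  exists! F : gfunctor (tau X) G, hcomp (nerve_map F) (unit_map X) = f.
Proof.
exists (tau_ext f); split; first exact: tau_extE.
by move=> F /tau_ext_unique.
Qed.

Definition embeddable (X : partial_groupoid) : Prop := monomorphism (unit_map X).

(** * Pushouts of symmetric sets *)

Section Pushout.
Variables (A B C : symset) (f : hom A B) (g : hom A C).

Definition po_rel n (u v : (B n + C n)%type) : Prop :=
  exists a : A n, u = inl (f n a) /\ v = inr (g n a).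

Definition po_act0 m n (a : 'I_m.+1 -> 'I_n.+1) (u : (B n + C n)%type) :
    (B m + C m)%type :=
  match u with inl b => inl (act a b) | inr c => inr (act a c) end.

Definition po_act m n (a : 'I_m.+1 -> 'I_n.+1) : quot (@po_rel n) -> quot (@po_rel m) :=
  quot_lift (fun u => class (@po_rel m) (po_act0 a u)).

Lemma po_actE m n (a : 'I_m.+1 -> 'I_n.+1) u :
  po_act a (class (@po_rel n) u) = class (@po_rel m) (po_act0 a u).
Proof.
rewrite /po_act quot_liftE // => _ _ [x [-> ->]] /=.
by apply: class_eq; exists (act a x); rewrite !hnat.
Qed.

Definition pushout : symset.
Proof.
exists (fun n => quot (@po_rel n)) po_act.
- move=> n x; rewrite -[x]repK po_actE.
  by case: (rep x) => y /=; rewrite act_id.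
- move=> l m n a b x; rewrite -[x]repK !po_actE.
  by case: (rep x) => y /=; rewrite act_comp.
Defined.

Definition po_inl : hom B pushout.
Proof.
exists (fun n b => class (@po_rel n) (inl b)) => m n a b.
by rewrite /= po_actE.
Defined.

Definition po_inr : hom C pushout.
Proof.
exists (fun n c => class (@po_rel n) (inr c)) => m n a c.
by rewrite /= po_actE.
Defined.

Lemma po_comm : hcomp po_inl f = hcomp po_inr g.
Proof. by apply: hom_ext => n a; apply: class_eq; exists a. Qed.

Section Desc.
Variables (Z : symset) (h : hom B Z) (k : hom C Z).
Hypothesis hk : hcomp h f = hcomp k g.

Definition po_desc_cell n : pushout n -> Z n :=
  quot_lift (fun u : (B n + C n)%type => match u with inl b => h n b | inr c => k n c end).

Lemma po_desc_cellE n (u : (B n + C n)%type) :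
  po_desc_cell (class (@po_rel n) u) = match u with inl b => h n b | inr c => k n c end.
Proof.
rewrite /po_desc_cell quot_liftE // => _ _ [a [-> ->]].
exact: (f_equal (fun t : hom A Z => t n a) hk).
Qed.

Definition po_desc : hom pushout Z.
Proof.
exists po_desc_cell => m n a x; rewrite -[x]repK /= po_actE !po_desc_cellE.
by case: (rep x) => y /=; rewrite hnat.
Defined.

Lemma po_desc_universal :
  unique (fun d : hom pushout Z => hcomp d po_inl = h /\ hcomp d po_inr = k) po_desc.
Proof.
split.
  by split; apply: hom_ext => n x; rewrite /= po_desc_cellE.
move=> d [dh dk]; apply: hom_ext => n x; rewrite -[x]repK /= po_desc_cellE.
by case: (rep x) => y; rewrite -?dh -?dk.
Qed.

End Desc.
End Pushout.

(** * Symmetric subsets of representables *)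

Definition in_some n (C : {set {set 'I_n.+1}}) m (f : 'I_m.+1 -> 'I_n.+1) : bool :=
  [exists c in C, [forall i, f i \in c]].

Lemma in_some_act n (C : {set {set 'I_n.+1}}) l m (a : 'I_l.+1 -> 'I_m.+1)
    (f : 'I_m.+1 -> 'I_n.+1) : in_some C f -> in_some C (fun i => f (a i)).
Proof.
move=> /exists_inP[c cC /forallP fc].
by apply/exists_inP; exists c => //; apply/forallP.
Qed.

(* The symmetric subset of the representable on [n] consisting of the functions
   whose image is contained in a member of [C]. *)
Definition carried n (C : {set {set 'I_n.+1}}) : symset.
Proof.
exists (fun m => {f : 'I_m.+1 -> 'I_n.+1 | in_some C f})
       (fun l m a f => exist _ (fun i => sval f (a i)) (in_some_act a (svalP f))).
- by move=> m [f p] /=; apply: eq_exist.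
- by move=> k l m a b [f p] /=; apply: eq_exist.
Defined.

Lemma carried_inj n (C : {set {set 'I_n.+1}}) m (f g : carried C m) :
  sval f = sval g -> f = g.
Proof. by case: f g => [f p] [g q] /= fg; apply: eq_exist. Qed.

Definition refines n (C D : {set {set 'I_n.+1}}) : Prop :=
  forall c, c \in C -> exists2 d, d \in D & c \subset d.

Lemma in_some_refines n (C D : {set {set 'I_n.+1}}) m (f : 'I_m.+1 -> 'I_n.+1) :
  refines C D -> in_some C f -> in_some D f.
Proof.
move=> CD /exists_inP[c /CD[d dD /subsetP cd] /forallP fc].
by apply/exists_inP; exists d => //; apply/forallP => i; apply: cd.
Qed.

Definition carried_incl n (C D : {set {set 'I_n.+1}}) (CD : refines C D) :
  hom (carried C) (carried D).
Proof.
exists (fun m (f : carried C m) =>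
          exist _ (sval f) (in_some_refines CD (svalP f)) : carried D m).
by move=> l m a f; apply: eq_exist.
Defined.

Lemma refines_trans n (C D E : {set {set 'I_n.+1}}) :
  refines C D -> refines D E -> refines C E.
Proof.
move=> CD DE c /CD[d /DE[e eE de] cd]; exists e => //.
exact: subset_trans cd de.
Qed.

(** * Triangulations of polygons *)

Definition spine_sets n : {set {set 'I_n.+1}} :=
  [set [set widen_ord (leqnSn n) i; lift ord0 i] | i : 'I_n].

Definition circular_spine_sets n : {set {set 'I_n.+1}} :=
  [set ord0; ord_max] |: spine_sets n.

Definition crosses n (c d : {set 'I_n.+1}) : bool :=
  [exists i in c, exists j in d, exists k in c, exists l in d,
     [&& i < j, j < k & k < l]].

(* A chord is a set of two vertices: a side or a diagonal of the polygon. *)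
Definition noncrossing n (D : {set {set 'I_n.+1}}) : bool :=
  [forall c in D, #|c| == 2] && [forall c in D, forall d in D, ~~ crosses c d].

Definition triangles_of n (D : {set {set 'I_n.+1}}) : {set {set 'I_n.+1}} :=
  [set t : {set 'I_n.+1} | (#|t| == 3) &&
     [forall c : {set 'I_n.+1}, (#|c| == 2) && (c \subset t) ==> (c \in D)]].

(* A triangulation of the [n.+1]-gon with vertices [0, ..., n] in cyclic order is
   given by a maximal set of pairwise noncrossing chords, and then regarded as
   the set of its triangles. *)
Definition is_triangulation n (T : {set {set 'I_n.+1}}) : Prop :=
  exists2 D, maxset (@noncrossing n) D & T = triangles_of D.

Record triangulation n := Triangulation {
  triangles :> {set {set 'I_n.+1}};
  triangulation_polygon : 2 <= n;
  triangulationP : is_triangulation triangles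
}.

Section Sides.
Variables (n : nat) (D : {set {set 'I_n.+1}}).
Hypotheses (n2 : 2 <= n) (maxD : maxset (@noncrossing n) D).

Lemma chord_pair (c : {set 'I_n.+1}) :
  #|c| = 2 -> exists x y : 'I_n.+1, x < y /\ c = [set x; y].
Proof.
move=> /eqP/cards2P[x [y [xy ->]]].
have [lxy | lyx | e] := ltngtP x y.
- by exists x, y.
- by exists y, x; rewrite setUC.
- by case/eqP: xy; apply: val_inj.
Qed.

Lemma crosses_pairE (x y z w : 'I_n.+1) : x < y -> z < w ->
  crosses [set x; y] [set z; w] -> [/\ x < z, z < y & y < w].
Proof.
move=> xy zw /exists_inP[i ic] /exists_inP[j jd] /exists_inP[k kc].
move=> /exists_inP[l ld] /and3P[ij jk kl].
move: ic jd kc ld; rewrite !inE.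
by move=> /orP[]/eqP? /orP[]/eqP? /orP[]/eqP? /orP[]/eqP?; subst; split; lia.
Qed.

Lemma noncrossing_pair (x y z w : 'I_n.+1) :
  [set x; y] \in D -> [set z; w] \in D -> ~ [/\ x < z, z < y & y < w].
Proof.
have [/andP[_ /forall_inP ncD] _] := maxsetP maxD.
move=> xyD zwD [xz zy yw]; have /forall_inP/(_ _ zwD)/negP := ncD _ xyD; apply.
apply/exists_inP; exists x; first by rewrite !inE eqxx.
apply/exists_inP; exists z; first by rewrite !inE eqxx.
apply/exists_inP; exists y; first by rewrite !inE eqxx orbT.
apply/exists_inP; exists w; first by rewrite !inE eqxx orbT.
by rewrite xz zy yw.
Qed.

Lemma chord_max (x y : 'I_n.+1) : x < y ->
  (forall z w : 'I_n.+1, [set z; w] \in D -> z < w ->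
     ~ [/\ x < z, z < y & y < w] /\ ~ [/\ z < x, x < w & w < y]) ->
  [set x; y] \in D.
Proof.
move=> xy H.
have [/andP[/forall_inP D2 /forall_inP ncD] maxD'] := maxsetP maxD.
rewrite -(maxD' ([set x; y] |: D)) ?subsetUr //; first by rewrite !inE eqxx.
have xy2 : #|[set x; y]| = 2 by rewrite cards2; case: eqP xy => [->|//]; lia.
apply/andP; split.
  apply/forall_inP => c; rewrite !inE => /orP[/eqP-> | /D2 //]; exact/eqP.
apply/forall_inP => c cD; apply/forall_inP => d dD; apply/negP.
move: cD dD; rewrite !inE => /orP[/eqP-> | cD] /orP[/eqP-> | dD].
- by move=> /crosses_pairE[] //; lia.
- have [z [w [zw e]]] := chord_pair (eqP (D2 _ dD)); subst d.
  by move=> /crosses_pairE h; apply: (H _ _ dD zw).1; exact: h.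
- have [z [w [zw e]]] := chord_pair (eqP (D2 _ cD)); subst c.
  by move=> /crosses_pairE h; apply: (H _ _ cD zw).2; exact: h.
- by apply/negP; have /forall_inP := ncD _ cD; apply.
Qed.

Lemma chord_max_sym (x y : 'I_n.+1) : x != y :> nat ->
  (forall z w : 'I_n.+1, [set z; w] \in D -> z < w ->
     ~ [/\ minn x y < z, z < maxn x y & maxn x y < w] /\
     ~ [/\ z < minn x y, minn x y < w & w < maxn x y]) ->
  [set x; y] \in D.
Proof.
case: ltngtP => // xy _ H; first exact: chord_max.
rewrite setUC; exact: chord_max.
Qed.

Lemma side_chord (i j : 'I_n.+1) :
  (j = i.+1 :> nat) \/ (i = n :> nat /\ j = 0 :> nat) -> [set i; j] \in D.
Proof.
move=> ij; apply: chord_max_sym; first by lia.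
move=> z w _ zw; have := ltn_ord z; have := ltn_ord w.
by split=> -[]; lia.
Qed.

Lemma side_triangle (i j : 'I_n.+1) :
  (j = i.+1 :> nat) \/ (i = n :> nat /\ j = 0 :> nat) ->
  exists2 t, t \in triangles_of D & [set i; j] \subset t.
Proof.
move=> ij.
pose cyc (k : 'I_n.+1) := if i < k then k - i else k + n.+1 - i.
pose P (k : 'I_n.+1) := [&& k != i, k != j & [set i; k] \in D].
have [p pi] : exists p : 'I_n.+1,
    (i = p.+1 :> nat) \/ (p = n :> nat /\ i = 0 :> nat).
  have [i0 | i0] := posnP i; first by exists ord_max; right.
  have lt : i.-1 < n.+1 by have := ltn_ord i; lia.
  by exists (Ordinal lt); left; rewrite /= prednK.
have Pp : P p.
  rewrite /P setUC side_chord // andbT; apply/andP; split.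
    by apply/eqP => e; subst p; lia.
  by apply/eqP => e; subst p; lia.
case: (arg_minnP cyc Pp) => k /and3P[ki kj ikD] kmin.
have kiN : k != i :> nat by [].
have kjN : k != j :> nat by [].
have ijN : i != j :> nat by lia.
have kiD : [set k; i] \in D by rewrite setUC.
have jkD : [set j; k] \in D.
  apply: chord_max_sym; first by rewrite eq_sym.
  move=> z w zwD zw.
  have wzD : [set w; z] \in D by rewrite setUC.
  have := ltn_ord z; have := ltn_ord w; have := ltn_ord i; have := ltn_ord k.
  have hz : z = i \/ (z != i :> nat) by case: (eqVneq z i); [left | right].
  have hw : w = i \/ (w != i :> nat) by case: (eqVneq w i); [left | right].
  case: hz => [zi | zi].
    subst z; have : w != j :> nat -> w != i :> nat -> cyc k <= cyc w.
      by move=> wj wi; apply: kmin; rewrite /P zwD andbT; apply/andP.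
    rewrite /cyc => H *; split=> -[a b c];
      have {}H := H ltac:(lia) ltac:(lia); move: H;
      case: (ltnP i k); case: (ltnP i w); lia.
  case: hw => [wi | wi].
    subst w; have : z != j :> nat -> z != i :> nat -> cyc k <= cyc z.
      by move=> wj wi; apply: kmin; rewrite /P wzD andbT; apply/andP.
    rewrite /cyc => H *; split=> -[a b c];
      have {}H := H ltac:(lia) ltac:(lia); move: H;
      case: (ltnP i k); case: (ltnP i z); lia.
  have N1 := noncrossing_pair ikD zwD; have N2 := noncrossing_pair zwD ikD.
  have N3 := noncrossing_pair kiD zwD; have N4 := noncrossing_pair zwD kiD.
  have {}N1 : ~ (i < z /\ z < k /\ k < w) by move=> [? []] *; apply: N1; split.
  have {}N2 : ~ (z < i /\ i < w /\ w < k) by move=> [? []] *; apply: N2; split.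
  have {}N3 : ~ (k < z /\ z < i /\ i < w) by move=> [? []] *; apply: N3; split.
  have {}N4 : ~ (z < k /\ k < w /\ w < i) by move=> [? []] *; apply: N4; split.
  by move=> *; split=> -[]; lia.
exists [set i; j; k]; last exact: subsetUl.
have ijD := side_chord ij.
rewrite inE; apply/andP; split.
  have -> : [set i; j; k] = k |: [set i; j] by rewrite setUC.
  by rewrite cardsU1 cards2 !inE negb_or ki kj -val_eqE /= ijN.
apply/forallP => c; apply/implyP => /andP[/eqP/chord_pair[x [y [xy ->]]]].
rewrite subUset !sub1set !inE.
move=> /andP[/orP[/orP[]|]/eqP? /orP[/orP[]|]/eqP?]; subst => //;
  by [rewrite ltnn in xy | rewrite setUC].
Qed.

End Sides.

Lemma spine_refines_circular n : refines (spine_sets n) (circular_spine_sets n).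
Proof. by move=> c cS; exists c; rewrite // inE cS orbT. Qed.

Lemma circular_refines_triangulation n (T : triangulation n) :
  refines (circular_spine_sets n) T.
Proof.
have n2 := triangulation_polygon T.
have [D maxD ->] := triangulationP T.
move=> c; rewrite !inE => /orP[/eqP-> | /imsetP[i _ ->]].
  by rewrite setUC; apply: side_triangle => //; right.
by apply: side_triangle => //; left.
Qed.

(** * The maps [NA -> A] *)

Definition Sp n : symset := carried (spine_sets n).

Definition cSp n : symset := carried (circular_spine_sets n).

Section Pair.
Variable n : nat.

Definition H_tri (T : triangulation n) : symset := carried T.

Definition Sp_cSp : hom (Sp n) (cSp n) := carried_incl (@spine_refines_circular n).

Definition cSp_H (T : triangulation n) : hom (cSp n) (H_tri T) :=
  carried_incl (@circular_refines_triangulation n T).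

Definition Sp_H (T : triangulation n) : hom (Sp n) (H_tri T) := hcomp (cSp_H T) Sp_cSp.

Variables T T' : triangulation n.

Definition A_symset : symset := pushout (cSp_H T) (cSp_H T').

Definition NA_symset : symset := pushout (Sp_H T) (Sp_H T').

Definition A_inl : hom (H_tri T) A_symset := po_inl (cSp_H T) (cSp_H T').

Definition A_inr : hom (H_tri T') A_symset := po_inr (cSp_H T) (cSp_H T').

Lemma NA_to_A_compat : hcomp A_inl (Sp_H T) = hcomp A_inr (Sp_H T').
Proof.
apply: hom_ext => m s.
exact: (f_equal (fun t : hom (cSp n) A_symset => t m (Sp_cSp m s))
                (po_comm (cSp_H T) (cSp_H T'))).
Qed.

Definition NA_to_A : hom NA_symset A_symset := po_desc NA_to_A_compat.

Definition well_behaved : Prop := spiny A_symset.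

End Pair.

Lemma segal_nat (X Y : symset) (f : hom X Y) m (x y : X m) :
  segal x = segal y -> segal (f m x) = segal (f m y).
Proof.
move=> xy; apply/funext => i; rewrite /segal /edge -!hnat.
by congr (f 1 _); apply: (f_equal (fun w => w i) xy).
Qed.

Section Spiny.
Variables (n : nat) (T T' : triangulation n).

Definition po_val m (u : (H_tri T m + H_tri T' m)%type) : 'I_m.+1 -> 'I_n.+1 :=
  match u with inl f => sval f | inr f => sval f end.

Lemma glued (S : symset) (f : hom S (H_tri T)) (g : hom S (H_tri T')) C m
    (u v : (H_tri T m + H_tri T' m)%type) :
  (forall s : S m, sval (f m s) = sval (g m s) /\ in_some C (sval (f m s))) ->
  class (@po_rel _ _ _ f g m) u = class (@po_rel _ _ _ f g m) v ->
  u = v \/ po_val u = po_val v /\ in_some C (po_val u).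
Proof.
move=> fg /classE; elim=> {u v}.
- by move=> _ _ [s [-> ->]]; right; apply: fg.
- by left.
- by move=> u v _ [-> | [<- c]]; [left | right].
- by move=> u v w _ [-> // | [uv c]] _ [<- | [<- _]]; right.
Qed.

Lemma glued_NA m (u v : (H_tri T m + H_tri T' m)%type) :
  class (@po_rel _ _ _ (Sp_H T) (Sp_H T') m) u =
  class (@po_rel _ _ _ (Sp_H T) (Sp_H T') m) v ->
  u = v \/ po_val u = po_val v /\ in_some (spine_sets n) (po_val u).
Proof. by apply: glued => s; split=> //; exact: (proj2_sig s). Qed.

Lemma glued_A m (u v : (H_tri T m + H_tri T' m)%type) :
  class (@po_rel _ _ _ (cSp_H T) (cSp_H T') m) u =
  class (@po_rel _ _ _ (cSp_H T) (cSp_H T') m) v ->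
  u = v \/ po_val u = po_val v /\ in_some (circular_spine_sets n) (po_val u).
Proof. by apply: glued => s; split=> //; exact: (proj2_sig s). Qed.

Lemma spine_endpoints (c : {set 'I_n.+1}) :
  c \in spine_sets n -> ord0 \in c -> ord_max \in c -> False.
Proof.
have n2 := triangulation_polygon T.
move=> /imsetP[i _ ->]; rewrite !inE -!val_eqE /= /bump /=.
by have := ltn_ord i; lia.
Qed.

Lemma spine_const (k : 'I_n.+1) : exists2 c, c \in spine_sets n & k \in c.
Proof.
have n2 := triangulation_polygon T.
case: (ltnP k n) => kn.
  exists [set widen_ord (leqnSn n) (Ordinal kn); lift ord0 (Ordinal kn)].
    exact: imset_f.
  by rewrite !inE -!val_eqE /= eqxx.
have pn : n.-1 < n by lia.
exists [set widen_ord (leqnSn n) (Ordinal pn); lift ord0 (Ordinal pn)].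
  exact: imset_f.
by rewrite !inE -!val_eqE /= /bump /=; have := ltn_ord k; lia.
Qed.

Lemma spine_of_edges m (f : 'I_m.+1 -> 'I_n.+1) :
  in_some (circular_spine_sets n) f ->
  (forall i : 'I_m, in_some (spine_sets n)
     (fun k => f (pair_map (widen_ord (leqnSn m) i) (lift ord0 i) k))) ->
  in_some (spine_sets n) f.
Proof.
move=> /exists_inP[c]; rewrite !inE => /orP[/eqP-> /forallP fc fe | cS fc _]; last first.
  by apply/exists_inP; exists c.
have step (i : 'I_m) : f (widen_ord (leqnSn m) i) = f (lift ord0 i).
  have /exists_inP[d dS /forallP fd] := fe i.
  have := fd ord0; have := fd ord_max; rewrite /pair_map /=.
  have := fc (widen_ord (leqnSn m) i); have := fc (lift ord0 i); rewrite !inE.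
  move=> /orP[]/eqP-> /orP[]/eqP-> // h k.
  - by case: (spine_endpoints dS).
  - by case: (spine_endpoints dS).
have const k (km : k < m.+1) : f (Ordinal km) = f ord0.
  elim: k km => [|k IH] km; first by congr f; apply: val_inj.
  have km' : k < m by [].
  rewrite -(IH (ltnW km)); have := step (Ordinal km').
  have -> : widen_ord (leqnSn m) (Ordinal km') = Ordinal (ltnW km) by apply: val_inj.
  by have -> : lift ord0 (Ordinal km') = Ordinal km by apply: val_inj.
have [d dS fd] := spine_const (f ord0).
by apply/exists_inP; exists d => //; apply/forallP => -[k km]; rewrite const.
Qed.

Lemma NA_glue m (u v : (H_tri T m + H_tri T' m)%type) :
  po_val u = po_val v -> in_some (spine_sets n) (po_val u) ->
  class (@po_rel _ _ _ (Sp_H T) (Sp_H T') m) u =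
  class (@po_rel _ _ _ (Sp_H T) (Sp_H T') m) v.
Proof.
pose sp (f : 'I_m.+1 -> 'I_n.+1) (p : in_some (spine_sets n) f) : Sp n m := exist _ f p.
case: u v => [f|f] [g|g] /=.
- by move=> fg _; rewrite (carried_inj fg).
- by move=> fg p; apply: class_eq; exists (sp _ p); split; congr (_ _); apply: carried_inj.
- move=> fg p; apply: esym; apply: class_eq; exists (sp _ p).
  by split; congr (_ _); apply: carried_inj.
- by move=> fg _; rewrite (carried_inj fg).
Qed.

Lemma NA_to_A_class m u :
  NA_to_A T T' m (class _ u) = class (@po_rel _ _ _ (cSp_H T) (cSp_H T') m) u.
Proof. by rewrite /= (po_desc_cellE (NA_to_A_compat T T')); case: u. Qed.

Lemma NA_segal m (u v : (H_tri T m + H_tri T' m)%type) :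
  @segal (NA_symset T T') m (class _ u) = @segal (NA_symset T T') m (class _ v) ->
  forall i : 'I_m,
    let a := pair_map (widen_ord (leqnSn m) i) (lift ord0 i) in
    class (@po_rel _ _ _ (Sp_H T) (Sp_H T') 1) (po_act0 a u) =
    class (@po_rel _ _ _ (Sp_H T) (Sp_H T') 1) (po_act0 a v).
Proof.
move=> uv i a; rewrite -!po_actE.
exact: (f_equal (fun w => w i) uv).
Qed.

Lemma NA_spiny : well_behaved T T' -> spiny (NA_symset T T').
Proof.
move=> wb m m1 x y; rewrite -[x]repK -[y]repK.
move: (rep x) (rep y) => u v {x y} uv.
have := wb m m1 _ _ (segal_nat (NA_to_A T T') uv); rewrite !NA_to_A_class.
case/glued_A => [-> // | [e c]].
have E := NA_segal uv.
case: u v e c E {uv} => [f|f] [g|g] /= e c E.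
- by rewrite (carried_inj e).
- apply: NA_glue => //=; apply: spine_of_edges => // i.
  by have /glued_NA[|[]] := E i.
- apply: NA_glue => //=; apply: spine_of_edges => // i.
  by have /glued_NA[|[]] := E i.
- by rewrite (carried_inj e).
Qed.

End Spiny.

Definition A_pg n (T T' : triangulation n) (wb : well_behaved T T') : partial_groupoid :=
  PartialGroupoid wb.

Definition NA_pg n (T T' : triangulation n) (wb : well_behaved T T') : partial_groupoid :=
  PartialGroupoid (NA_spiny wb).

(* Main.v *)
Require Import Defs.
From mathcomp Require Import all_boot boolp zify.

(** Call a word of edges of [X] an expansion of an edge [e] if it arises from [e]
    by replacing letters [c] with [a b] whenever [c = a b] holds in a 2-cell.  Such
    an expansion is the same as a triangulated polygon whose triangles are
    labelled by 2-cells of [X], with the word along the spine and [e] on the long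
    side [{0, n}].  Both directions compare two triangulated polygons with the same
    spine.

    Let [X] be embeddable.  A map from [NA] to [X] gives two labelled polygons with
    the same spine.  In [tau X] both long sides equal the composite of the spine
    ([extend_chord]), hence they are equal in [X] ([long_edge_eq]), and the map
    factors through [A]; uniqueness is clear since [NA -> A] is surjective.

    Conversely let [X] be orthogonal to the maps [NA -> A].  Because [X] is spiny,
    it suffices to show that two edges [e], [e'] with the same image in [tau X]
    are equal.  First, [e] and [e'] have a common expansion
    ([joinable_tau_gen]).  Indeed, having a common expansion is a congruence on
    composable words: the only issue is transitivity, that is, the confluence of
    expansions, and this follows by re-rooting polygons at another side
    ([expands_confluent1]).  So [e] and [e'] are the long sides of two labelled
    polygons with the same spine ([expands_labelled]).  If the two triangulations
    share an ear, the two copies of this ear are equal because [X] is spiny, and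
    it can be cut off.  If they share no ear, the pair is well-behaved
    ([no_ear_well_behaved]): two cells of [A] with the same spine could differ only
    on a triangle that belongs to both triangulations and has two sides on the
    boundary.  Orthogonality then extends the map from [NA] given by the labels to
    [A], so [e = e'] ([root_unique]). *)

Set Implicit Arguments.
Unset Strict Implicit.
Unset Printing Implicit Defensive.

(** * Words of edges and their expansions *)

Notation src e := (vertex (@ord0 1) e).
Notation tgt e := (vertex (@ord_max 1) e).

Definition tuple_map (T : Type) (x y z : T) : 'I_3 -> T :=
  fun i => if i == 0 :> nat then x else if i == 1 :> nat then y else z.

Section Cells.
Variable X : symset.

Definition inv_edge (e : X 1) : X 1 := edge ord_max ord0 e.

Definition id_edge (x : X 0) : X 1 := act (fun=> ord0) x.

Lemma edge_diag n (i : 'I_n.+1) (x : X n) : edge i i x = id_edge (vertex i x).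
Proof.
by rewrite /edge /id_edge /vertex -act_comp; congr act; apply/funext => k; rewrite /pair_map if_same.
Qed.

Lemma inv_edgeE n (i j : 'I_n.+1) (x : X n) : inv_edge (edge i j x) = edge j i x.
Proof. exact: edge_act. Qed.

Lemma inv_edgeK : involutive inv_edge.
Proof. by move=> e; rewrite inv_edgeE edge_full. Qed.

Lemma src_inv (e : X 1) : src (inv_edge e) = tgt e.
Proof. exact: src_edge. Qed.

Lemma tgt_inv (e : X 1) : tgt (inv_edge e) = src e.
Proof. exact: tgt_edge. Qed.

Lemma src_id (x : X 0) : src (id_edge x) = x.
Proof. by rewrite vertex_act vertex_point. Qed.

Lemma tgt_id (x : X 0) : tgt (id_edge x) = x.
Proof. by rewrite vertex_act vertex_point. Qed.

(** The relation [c = a b] imposed by a 2-cell; these are the relations of the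
    fundamental groupoid [tau X]. *)
Definition tri (a b c : X 1) : Prop :=
  exists s : X 2, [/\ edge (@inord 2 0) (@inord 2 1) s = a,
    edge (@inord 2 1) (@inord 2 2) s = b & edge (@inord 2 0) (@inord 2 2) s = c].

Lemma tri_cell n (x : X n) (i j k : 'I_n.+1) :
  tri (edge i j x) (edge j k x) (edge i k x).
Proof.
by exists (act (tuple_map i j k) x); rewrite !edge_act /tuple_map !inordK.
Qed.

Lemma tri_ends a b c :
  tri a b c -> [/\ src a = src c, tgt a = src b & tgt b = tgt c].
Proof. by case=> s [<- <- <-]; rewrite !src_edge !tgt_edge. Qed.

(** The symmetries of a 2-cell turn [c = a b] into [a = c b^-1]: any of the three
    edges of a triangle can serve as the long one. *)
Lemma tri_reroot a b c : tri a b c -> tri c (inv_edge b) a.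
Proof. by case=> s [<- <- <-]; rewrite inv_edgeE; exact: tri_cell. Qed.

Lemma tri_inv a b c : tri a b c -> tri (inv_edge b) (inv_edge a) (inv_edge c).
Proof. by case=> s [<- <- <-]; rewrite !inv_edgeE; exact: tri_cell. Qed.

Lemma tri_idl e : tri (id_edge (src e)) e e.
Proof. by have := tri_cell e ord0 ord0 ord_max; rewrite edge_full edge_diag. Qed.

Lemma tri_idr e : tri e (id_edge (tgt e)) e.
Proof. by have := tri_cell e ord0 ord_max ord_max; rewrite edge_full edge_diag. Qed.

Lemma tri_invr e : tri e (inv_edge e) (id_edge (src e)).
Proof. by have := tri_cell e ord0 ord_max ord0; rewrite edge_full edge_diag. Qed.

(** A cell of a spiny symmetric set is determined by all its edges; the case
    [n = 0] needs no spininess, the vertex being the source of its degenerate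
    edge. *)
Lemma cell_ext n (x y : X n) : spiny X ->
  (forall i j, edge i j x = edge i j y) -> x = y.
Proof.
case: n x y => [|n] x y spX xy.
  by rewrite -[x]vertex_point -[y]vertex_point -(src_edge ord0 ord0 x) xy src_edge.
by apply: (spX n.+1) => //; apply/funext => i; apply: xy.
Qed.

Lemma tri_unique a b c c' : spiny X -> tri a b c -> tri a b c' -> c = c'.
Proof.
move=> spX [s [<- <- <-]] [s' [h0 h1 <-]]; congr (edge _ _ _).
apply: (spX 2) => //; apply/funext => i; rewrite /segal.
have E k (p : k < 2.+1) (j : 'I_3) : j = k :> nat -> j = inord k.
  by move=> jk; apply: val_inj; rewrite /= inordK.
case: i => [[|[|//]] lti].
  by rewrite (E 0 _ (widen_ord _ _)) // (E 1 _ (lift _ _)).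
by rewrite (E 1 _ (widen_ord _ _)) // (E 2 _ (lift _ _)).
Qed.

(** Only expansions [c -> a b] are allowed, never contractions.  From a one-letter
    word, a sequence of such steps builds up a triangulated polygon, with the
    letter on the long side and the final word along the spine. *)
Inductive expands (u : seq (X 1)) : seq (X 1) -> Prop :=
| expands_refl : expands u u
| expands_step l a b c r :
    expands u (l ++ c :: r) -> tri a b c -> expands u (l ++ a :: b :: r).

Lemma expands_trans v u w : expands u v -> expands v w -> expands u w.
Proof.
by move=> uv; elim=> // l a b c r _ IH t; apply: expands_step t.
Qed.

Lemma expands_tri a b c : tri a b c -> expands [:: c] [:: a; b].
Proof. by apply: (@expands_step _ [::] a b c [::]); exact: expands_refl. Qed.

Lemma expands_catl l u w : expands u w -> expands (l ++ u) (l ++ w).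
Proof.
elim=> [|l' a b c r _ IH t]; first exact: expands_refl.
by rewrite catA; apply: expands_step t; rewrite -catA.
Qed.

Lemma expands_catr r u w : expands u w -> expands (u ++ r) (w ++ r).
Proof.
elim=> [|l a b c r' _ IH t]; first exact: expands_refl.
by rewrite -catA; apply: expands_step t; move: IH; rewrite -catA.
Qed.

Lemma expands_cat u1 u2 w1 w2 :
  expands u1 w1 -> expands u2 w2 -> expands (u1 ++ u2) (w1 ++ w2).
Proof.
by move=> h1 h2; apply: expands_trans (expands_catr _ h1) (expands_catl _ h2).
Qed.

Lemma expands_nonnil u w : expands u w -> u <> [::] -> w <> [::].
Proof. by case=> // l a b c r _ _ _; case: l. Qed.

Lemma cat_split (T : Type) (l r w1 w2 : seq T) (c : T) :
  l ++ c :: r = w1 ++ w2 ->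
  (exists r1, r = r1 ++ w2 /\ w1 = l ++ c :: r1) \/
  (exists l2, l = w1 ++ l2 /\ w2 = l2 ++ c :: r).
Proof.
elim: l w1 => [|x l IH] [|y w1] /=.
- by move=> <-; right; exists [::].
- by case=> <- ->; left; exists w1.
- by move=> <-; right; exists (x :: l).
- case=> <- /IH[[r1 [-> ->]] | [l2 [-> ->]]]; first by left; exists r1.
  by right; exists l2.
Qed.

Lemma expands_split u1 u2 w : expands (u1 ++ u2) w ->
  exists w1 w2, [/\ w = w1 ++ w2, expands u1 w1 & expands u2 w2].
Proof.
elim=> [|l a b c r _ [w1 [w2 [e h1 h2]]] t].
  by exists u1, u2; split=> //; exact: expands_refl.
case: (cat_split e) h1 h2 => [[r1 [-> ->]] | [l2 [-> ->]]] h1 h2.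
  exists (l ++ a :: b :: r1), w2; split=> //; first by rewrite -catA.
  exact: expands_step t.
exists w1, (l2 ++ a :: b :: r); split=> //; first by rewrite -catA.
exact: expands_step t.
Qed.

Definition inv_word (w : seq (X 1)) : seq (X 1) := rev (map inv_edge w).

Lemma inv_wordK : involutive inv_word.
Proof. by move=> w; rewrite /inv_word map_rev revK mapK //; exact: inv_edgeK. Qed.

Lemma inv_word_cat u w : inv_word (u ++ w) = inv_word w ++ inv_word u.
Proof. by rewrite /inv_word map_cat rev_cat. Qed.

Lemma inv_word_cons e w : inv_word (e :: w) = inv_word w ++ [:: inv_edge e].
Proof. by rewrite -cat1s inv_word_cat. Qed.

Lemma expands_inv u w : expands u w -> expands (inv_word u) (inv_word w).
Proof.
elim=> [|l a b c r _ IH t]; first exact: expands_refl.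
move: IH; rewrite !inv_word_cat !inv_word_cons -!catA /=.
by move/expands_step; apply; apply: tri_inv.
Qed.

(** Re-rooting the polygon that expands [c] into [a v]: seen from its side [a], the
    other sides read [c v^-1]. *)
Lemma expands_reroot c a v : expands [:: c] (a :: v) -> expands [:: a] (c :: inv_word v).
Proof.
move e: (a :: v) => w h; elim: h a v e => [|l a' b' c' r _ IH t] a v.
  by case=> -> ->; exact: expands_refl.
case: l IH => [|x l] IH /= [-> ->].
  (* the first letter [c'] of the word is the one expanded, into [a' b'] *)
  have h := expands_tri (tri_reroot t).
  apply: expands_trans h _; rewrite inv_word_cons.
  by have := expands_catr [:: inv_edge b'] (IH _ _ erefl).
apply: expands_trans (IH _ _ erefl) _; apply: (expands_catl [:: c]).
by apply: expands_inv; apply: expands_step t; exact: expands_refl.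
Qed.

Fixpoint chain (x : X 0) (w : seq (X 1)) (y : X 0) : Prop :=
  if w is e :: w' then src e = x /\ chain (tgt e) w' y else x = y.

Lemma chain_cat x u w y :
  chain x (u ++ w) y <-> exists2 z, chain x u z & chain z w y.
Proof.
elim: u x => [|e u IH] x /=; first by split=> [| [z ->]]; [exists x|].
split=> [[<- /IH[z h1 h2]] | [z [<- h1] h2]]; first by exists z.
by split=> //; apply/IH; exists z.
Qed.

Lemma expands_chain u w x y : expands u w -> chain x u y -> chain x w y.
Proof.
elim=> // l a b c r _ IH t /IH/chain_cat[z h1 /= [h2 h3]].
by have [ac ab bc] := tri_ends t; apply/chain_cat; exists z => //=; rewrite ac ab bc.
Qed.

Lemma chain_inv x w y : chain x w y -> chain y (inv_word w) x.
Proof.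
elim: w x => [|e w IH] x /=; first by move->.
move=> [<- /IH h]; rewrite inv_word_cons; apply/chain_cat; exists (tgt e) => //=.
by rewrite src_inv tgt_inv.
Qed.

(** A word followed by its inverse is created from an identity by nested
    insertions [e e^-1]; the chain condition says that the identities between
    consecutive letters match. *)
Lemma expands_id x w y : chain x w y -> w <> [::] ->
  expands [:: id_edge x] (w ++ inv_word w).
Proof.
elim: w x => // e w IH x [<- ch] _.
have h := expands_tri (tri_invr e).
case: w IH ch => [|f w] IH ch; first exact: h.
rewrite inv_word_cons (catA (e :: _)) -(cat1s e) -(catA [:: e]).
apply: expands_trans h _; rewrite -cat1s.
apply: expands_trans (_ : expands _ ([:: e; id_edge (tgt e)] ++ [:: inv_edge e])) _.
  by apply: expands_catr (expands_tri (tri_idr e)).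
by rewrite -cat1s; apply: expands_catr; apply: expands_catl (IH _ ch _).
Qed.

(** For words that are nonempty composable chains, having a common expansion is
    the congruence that defines [tau X]. *)
Definition joinable u w : Prop := exists2 z, expands u z & expands w z.

(** Let [c] expand into [w1 = a v] and into [w2].  Re-rooting gives
    [w1 -> c v^-1 v -> w2 v^-1 v], and [w2 -> w2 v^-1 v] by creating [v^-1 v] from
    the identity at the end of [w2].  Trying to close local peaks step by step
    would not do, since expansions never terminate. *)
Lemma expands_confluent1 c w1 w2 :
  expands [:: c] w1 -> expands [:: c] w2 -> joinable w1 w2.
Proof.
have chc : chain (src c) [:: c] (tgt c) by [].
case: w1 => [/expands_nonnil/(_ _)[]// | a v h1 h2].
have [ch1 ch2] := (expands_chain h1 chc, expands_chain h2 chc).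
exists (w2 ++ inv_word v ++ v).
  apply: expands_trans (_ : expands _ ((c :: inv_word v) ++ v)) _.
    by rewrite -cat1s; apply: expands_catr; apply: expands_reroot.
  by rewrite -cat1s -catA; apply: expands_catr.
case: v {h1} ch1 => [|b v] ch1; first by rewrite /= cats0; exact: expands_refl.
have : w2 <> [::] by apply: expands_nonnil h2 _.
case/lastP: w2 h2 ch2 => // z f h2 ch2 _.
move: ch2; rewrite -cats1 => /chain_cat[t _ [_ /= tf]].
rewrite -catA; apply: expands_catl.
apply: expands_trans (expands_tri (tri_idr f)) _.
apply: (expands_catl [:: f] (u := [:: _])).
have /chain_inv chv : chain (tgt a) (b :: v) (tgt c) by case: ch1.
rewrite -{2}[b :: v]inv_wordK.
rewrite tf; apply: expands_id chv _.
by rewrite inv_word_cons; case: (inv_word v).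
Qed.

Lemma expands_confluent u w1 w2 : expands u w1 -> expands u w2 -> joinable w1 w2.
Proof.
elim: u w1 w2 => [|c u IH] w1 w2.
  have nil w : expands [::] w -> w = [::].
    by elim=> // -[|? ?] a b c' r _ h _.
  by move=> /nil-> /nil->; exists [::]; exact: expands_refl.
rewrite -cat1s => /expands_split[z1 [v1 [-> hz1 hv1]]] /expands_split[z2 [v2 [-> hz2 hv2]]].
have [z h1 h2] := expands_confluent1 hz1 hz2; have [v k1 k2] := IH _ _ hv1 hv2.
by exists (z ++ v); apply: expands_cat.
Qed.

Lemma joinable_sym u w : joinable u w -> joinable w u.
Proof. by case=> z; exists z. Qed.

Lemma joinable_trans u v w : joinable u v -> joinable v w -> joinable u w.
Proof.
move=> [z1 uz1 vz1] [z2 vz2 wz2]; have [z h1 h2] := expands_confluent vz1 vz2.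
by exists z; [apply: expands_trans h1 | apply: expands_trans h2].
Qed.

Lemma expands_joinable u w : expands u w -> joinable u w.
Proof. by exists w => //; exact: expands_refl. Qed.

Fixpoint word_of x y (f : @gexp X x y) : seq (X 1) :=
  match f with
  | egen _ _ e _ _ => [:: e]
  | eid x => [:: id_edge x]
  | ecomp _ _ _ f g => word_of f ++ word_of g
  | einv _ _ f => inv_word (word_of f)
  end.

Lemma word_of_chain x y (f : @gexp X x y) : chain x (word_of f) y /\ word_of f <> [::].
Proof.
elim: f => {x y} [x y e p q | x | x y z f [hf nf] g [hg ng] | x y f [hf nf]] /=.
- by [].
- by rewrite src_id tgt_id.
- by split; [apply/chain_cat; exists y | case: (word_of f) nf].
- split; first exact: chain_inv.
  by case: (word_of f) nf => // e w _; rewrite inv_word_cons; case: (inv_word w).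
Qed.

Lemma joinable_grel x y (f g : @gexp X x y) :
  @Defs.grel X x y f g -> joinable (word_of f) (word_of g).
Proof.
elim=> {x y f g} /=.
- move=> s v0 v1 v2 x y z _ _ _ _ _ _ _ _ _.
  by apply: joinable_sym; apply: expands_joinable; apply: expands_tri; exact: tri_cell.
- move=> x y f; have [] := word_of_chain f.
  case: (word_of f) => // e w [<- _] _; apply: joinable_sym; apply: expands_joinable.
  by have := expands_catr w (expands_tri (tri_idl e)).
- move=> x y f; have [] := word_of_chain f.
  case/lastP: (word_of f) => // w e; rewrite -cats1 => /chain_cat[t _ [_ /= <-]] _.
  apply: joinable_sym; apply: expands_joinable; rewrite -catA.
  exact: expands_catl (expands_tri (tri_idr e)).
- by move=> x y z t f g h; rewrite catA; apply: expands_joinable; exact: expands_refl.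
- move=> x y f; have [ch nf] := word_of_chain f.
  apply: joinable_sym; apply: expands_joinable; exact: expands_id ch nf.
- move=> x y f; have /= [ch nf] := word_of_chain (einv f).
  apply: joinable_sym; apply: expands_joinable.
  by rewrite -{2}[word_of f]inv_wordK; exact: expands_id ch nf.
- by move=> x y z f f' g _ [w h h']; exists (w ++ word_of g); apply: expands_catr.
- by move=> x y z f g g' _ [w h h']; exists (word_of f ++ w); apply: expands_catl.
- by move=> x y f f' _ [w h h']; exists (inv_word w); apply: expands_inv.
Qed.

(** Two edges that become equal in [tau X] are the long sides of two triangulated
    polygons with the same spine. *)
Lemma joinable_tau_gen (e e' : X 1) x y x' y'
    (p : src e = x) (q : tgt e = y) (p' : src e' = x') (q' : tgt e' = y') :
  arr (tau_gen p q) = arr (tau_gen p' q') -> joinable [:: e] [:: e'].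
Proof.
move=> h; have [ex ey] : (x, y) = (x', y') by exact: (f_equal (@projT1 _ _) h).
case: x' / ex p' h; case: y' / ey q' => q' p' /arr_inj/classE.
rewrite -[[:: e]]/(word_of (egen p q)) -[[:: e']]/(word_of (egen p' q')).
elim=> [f g | f | f g _ | f g k _ h1 _ h2].
- exact: joinable_grel.
- by apply: expands_joinable; exact: expands_refl.
- exact: joinable_sym.
- exact: joinable_trans h1 h2.
Qed.

End Cells.

(** * Triangulations as relations on natural numbers *)

(** [P i j], for [i < j], means that the chord [{i, j}] of the polygon with vertices
    [0, ..., n] is used.  Instead of maximality, which is awkward to maintain
    when vertices are added or removed, the axioms ask that each chord other
    than a side is the long side of a triangle; the two are equivalent by
    [triangulating_max] and [triangulating_chords_of].  The degenerate case
    [n = 1], a single edge, is allowed. *)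
Record triangulating (n : nat) (P : rel nat) : Prop := Triangulating {
  chord_lt : forall i j, P i j -> i < j <= n;
  chord_root : P 0 n;
  chord_side : forall i, i < n -> P i i.+1;
  chord_split : forall i j, P i j -> i.+1 < j -> exists2 k, P i k & P k j;
  chord_nc : forall x y z w, P x y -> P z w -> ~ [/\ x < z, z < y & y < w]
}.

(** Vertex [h] is the tip of an ear: its two cyclic neighbours are joined by a
    chord. *)
Definition ear n (P : rel nat) (h : nat) : bool :=
  if h == 0 then P 1 n else if h == n then P 0 n.-1 else P h.-1 h.+1.

Lemma bumpE h k : (k < h /\ bump h k = k) \/ (h <= k /\ bump h k = k.+1).
Proof. by rewrite /bump; case: leqP; [right | left]. Qed.

Lemma bump_id h k : k < h -> bump h k = k.
Proof. by case: (bumpE h k) => -[? ->] //; lia. Qed.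

Lemma bump_up h k : h <= k -> bump h k = k.+1.
Proof. by case: (bumpE h k) => -[? ->] //; lia. Qed.

Lemma bump_surj h k : k != h -> exists j, k = bump h j.
Proof. by move=> kh; exists (unbump h k); rewrite unbumpK. Qed.

Lemma bump_lt h i j : (bump h i < bump h j) = (i < j).
Proof. by case: (bumpE h i) => -[? ->]; case: (bumpE h j) => -[? ->]; lia. Qed.

(** Cutting off the ear at [h], with [bump h] enumerating the remaining vertices.
    The only chord that can be split at [h] is the base of the ear, which becomes
    a side, because this base isolates [h] from all vertices but its
    neighbours. *)
Lemma triangulating_remove n P h : 0 < n -> triangulating n.+1 P -> h <= n.+1 -> ear n.+1 P h ->
  triangulating n (fun i j => P (bump h i) (bump h j)).
Proof.
move=> n0 pP hn eh.
have eh' : 0 < h -> h <= n -> P h.-1 h.+1.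
  move=> h0 hn'; move: eh; rewrite /ear; case: eqP; first by lia.
  by case: eqP => //; lia.
split.
- move=> i j /(chord_lt pP).
  by case: (bumpE h i) => -[? ->]; case: (bumpE h j) => -[? ->]; lia.
- move: eh; rewrite /ear /bump; case: (posnP h) => [-> | h0] //=.
  case: eqP => [-> | hn']; first by rewrite ltnn.
  by have -> : h <= n by [lia]; have -> : h <= 0 = false by [lia]; rewrite chord_root.
- move=> i lti; case: (bumpE h i) => -[? ->]; case: (bumpE h i.+1) => -[? ->];
    try by apply: (chord_side pP); lia.
    by have := eh' ltac:(lia) ltac:(lia); have -> : h = i.+1 by lia.
  by lia.
- move=> i j Pij ltij.
  have /(chord_split pP)[|k Pik Pkj] := Pij.
    by case: (bumpE h i) => -[? ->]; case: (bumpE h j) => -[? ->]; lia.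
  have [kh | /bump_surj[l kl]] := eqVneq k h; last by exists l; rewrite -kl.
  subst k; have l1 := chord_lt pP Pik; have l2 := chord_lt pP Pkj.
  have {}eh' := eh' ltac:(lia) ltac:(lia).
  have N1 := chord_nc pP Pik eh'; have N2 := chord_nc pP eh' Pkj.
  have [] : bump h i = h.-1 /\ bump h j = h.+1.
    split; [case: (ltngtP (bump h i) h.-1) | case: (ltngtP (bump h j) h.+1)] => // ?.
    + by case: N1; split; lia.
    + by lia.
    + by lia.
    + by case: N2; split; lia.
  by case: (bumpE h i) => -[? ->]; case: (bumpE h j) => -[? ->]; lia.
- move=> x y z w Pxy Pzw [xz zy yw].
  by apply: (chord_nc pP Pxy Pzw); rewrite !bump_lt.
Qed.

(** Gluing an ear with tip [h] on the side [{h - 1, h}] of the old polygon, whose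
    vertices [h] and beyond are shifted by one. *)
Definition insert_chords (P : rel nat) (h : nat) : rel nat := fun i j =>
  if i == h then j == h.+1 else if j == h then i.+1 == h else P (unbump h i) (unbump h j).

Lemma unbumpE h k : (k <= h /\ unbump h k = k) \/ (h < k /\ unbump h k = k.-1).
Proof. by rewrite /unbump; case: ltnP => ?; [right | left]; split=> //=; lia. Qed.

Lemma unbump_id h k : k <= h -> unbump h k = k.
Proof. by case: (unbumpE h k) => -[? ->] //; lia. Qed.

Lemma unbump_up h k : h < k -> unbump h k = k.-1.
Proof. by case: (unbumpE h k) => -[? ->] //; lia. Qed.

Variant insert_spec (P : rel nat) (h : nat) : nat -> nat -> Prop :=
| InsertL : insert_spec P h h h.+1
| InsertR i : i.+1 = h -> insert_spec P h i h
| InsertO i j : P i j -> insert_spec P h (bump h i) (bump h j).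

Lemma insertP P h i j : insert_chords P h i j -> insert_spec P h i j.
Proof.
rewrite /insert_chords; case: eqVneq => [-> /eqP-> | ih]; first exact: InsertL.
case: eqVneq => [-> /eqP | jh]; first exact: InsertR.
have [i' ->] := bump_surj ih; have [j' ->] := bump_surj jh.
by rewrite !bumpK; exact: InsertO.
Qed.

Lemma insert_bump P h i j : insert_chords P h (bump h i) (bump h j) = P i j.
Proof.
have ne (k : nat) : (bump h k == h) = false by case: (bumpE h k) => -[? ->]; lia.
by rewrite /insert_chords !ne !bumpK.
Qed.

Lemma insert_at_l P h j : insert_chords P h h j = (j == h.+1).
Proof. by rewrite /insert_chords eqxx. Qed.

Lemma insert_at_r P h i : insert_chords P h i h = (i.+1 == h).
Proof. by rewrite /insert_chords eqxx; case: eqP => [->|//]; lia. Qed.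

Lemma insert_l P h : insert_chords P h h h.+1.
Proof. by rewrite /insert_chords !eqxx. Qed.

Lemma insert_r P h : insert_chords P h.+1 h h.+1.
Proof. by rewrite /insert_chords eqxx; case: eqP => //; lia. Qed.

Lemma triangulating_insert n P h : 0 < h -> h <= n -> triangulating n P ->
  triangulating n.+1 (insert_chords P h).
Proof.
case: h => // h _ hn pP.
split.
- move=> i j /insertP[|k kh|k l /(chord_lt pP)]; try lia.
  by case: (bumpE h.+1 k) => -[? ->]; case: (bumpE h.+1 l) => -[? ->]; lia.
- have := chord_root pP; rewrite -(insert_bump P h.+1) bump_id //.
  by rewrite bump_up.
- move=> i lti; case: (ltngtP i h) => [ih | ih | ->]; last exact: insert_r.
    have := insert_bump P h.+1 i i.+1; rewrite !bump_id; try lia.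
    by move=> ->; apply: (chord_side pP); lia.
  case: (ltngtP i h.+1) => [| ih' | ->]; [by lia | | exact: insert_l].
  have := insert_bump P h.+1 i.-1 i; rewrite !bump_up; try lia.
  rewrite prednK; last by lia.
  by move=> ->; rewrite -{2}[i]prednK; [apply: (chord_side pP) | ]; lia.
- move=> i j /insertP[|k kh|k l Pkl ltkl]; try lia.
  have [kl|kl] := ltnP k.+1 l.
    have [x Pkx Pxl] := chord_split pP Pkl kl.
    by exists (bump h.+1 x); rewrite insert_bump.
  have := chord_lt pP Pkl => lkl; exists h.+1.
    have -> : bump h.+1 k = h; last by rewrite insert_r.
    by move: ltkl; case: (bumpE h.+1 k) => -[? ->]; case: (bumpE h.+1 l) => -[? ->]; lia.
  have -> : bump h.+1 l = h.+2; last by rewrite insert_l.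
  by move: ltkl; case: (bumpE h.+1 k) => -[? ->]; case: (bumpE h.+1 l) => -[? ->]; lia.
- move=> x y z w /insertP[|i ih|i j Pij] /insertP[|k kh|k l Pkl] [xz zy yw]; try lia.
  by move: xz zy yw; rewrite !bump_lt => *; apply: (chord_nc pP Pij Pkl).
Qed.

(** An unused chord [{x, y}] crosses a used one: take a minimal used chord [{i, j}]
    that spans it; the vertex at which [{i, j}] splits lies strictly between [x] and
    [y], and one of the two halves crosses [{x, y}]. *)
Lemma chord_cover n P x y : triangulating n P -> x.+1 < y -> y <= n -> ~~ P x y ->
  exists i j, P i j /\ ([/\ x < i, i < y & y < j] \/ [/\ i < x, x < j & j < y]).
Proof.
move=> pP xy yn nP.
suff H d i j : j - i <= d -> P i j -> i <= x -> y <= j ->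
    exists i j, P i j /\ ([/\ x < i, i < y & y < j] \/ [/\ i < x, x < j & j < y]).
  by apply: (H n 0 n _ (chord_root pP)); lia.
elim: d i j => [|d IH] i j dij Pij ix yj; first by lia.
have [k Pik Pkj] : exists2 k, P i k & P k j by apply: (chord_split pP Pij); lia.
have l1 := chord_lt pP Pik; have l2 := chord_lt pP Pkj.
have [yk | ky] := leqP y k; first by apply: (IH i k); lia.
have [kx | xk] := leqP k x; first by apply: (IH k j); lia.
have [ix' | ix'] := ltnP i x; first by exists i, k; split=> //; right.
have [yj' | yj'] := ltnP y j; first by exists k, j; split=> //; left.
have ei : i = x by lia. have ej : j = y by lia.
by rewrite -ei -ej Pij in nP.
Qed.

Section ToSets.
Variable n : nat.
Implicit Types (P : rel nat) (i j k l : 'I_n.+1).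

Lemma pair_eq i j k l : i < j -> k < l ->
  [set i; j] = [set k; l] -> i = k /\ j = l.
Proof.
move=> ij kl e.
have hk : k \in [set i; j] by rewrite e set21.
have hl : l \in [set i; j] by rewrite e set22.
have hi : i \in [set k; l] by rewrite -e set21.
have hj : j \in [set k; l] by rewrite -e set22.
move: hk hl hi hj; rewrite !inE => /orP[]/eqP? /orP[]/eqP? /orP[]/eqP? /orP[]/eqP?;
  subst; split=> //; lia.
Qed.

Definition chord_set P : {set {set 'I_n.+1}} :=
  [set c : {set 'I_n.+1} | [exists i : 'I_n.+1, exists j : 'I_n.+1, P i j && (c == [set i; j])]].

Lemma chord_setP P c :
  reflect (exists i j, P i j /\ c = [set i; j]) (c \in chord_set P).
Proof.
rewrite inE; apply: (iffP existsP) => [[i /existsP[j /andP[p /eqP->]]] | [i [j [p ->]]]].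
  by exists i, j.
by exists i; apply/existsP; exists j; rewrite p eqxx.
Qed.

Lemma mem_chord_set P i j : triangulating n P -> i < j -> ([set i; j] \in chord_set P) = P i j.
Proof.
move=> pP ij; apply/chord_setP/idP => [[k [l [Pkl]]] | Pij]; last by exists i, j.
have /andP[kl _] := chord_lt pP Pkl.
by move/(pair_eq ij kl) => [-> ->].
Qed.

Lemma triangulating_noncrossing P : triangulating n P -> noncrossing (chord_set P).
Proof.
move=> pP; apply/andP; split.
  apply/forall_inP => c /chord_setP[i [j [Pij ->]]].
  by have := chord_lt pP Pij; rewrite cards2 -val_eqE /=; case: eqP => //=; lia.
apply/forall_inP => c /chord_setP[i [j [Pij ->]]].
apply/forall_inP => d /chord_setP[k [l [Pkl ->]]]; apply/negP => h.
have /andP[ij _] := chord_lt pP Pij; have /andP[kl _] := chord_lt pP Pkl.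
apply: (chord_nc pP Pij Pkl).
move: h => /exists_inP[x xc] /exists_inP[y yd] /exists_inP[z zc] /exists_inP[w wd].
move: xc yd zc wd; rewrite !inE => + + + + /and3P[xy yz zw].
by move=> /orP[]/eqP? /orP[]/eqP? /orP[]/eqP? /orP[]/eqP?; subst; split; lia.
Qed.

Lemma crosses_pair (x y z w : 'I_n.+1) :
  x < z -> z < y -> y < w -> crosses [set x; y] [set z; w].
Proof.
move=> xz zy yw.
apply/exists_inP; exists x; first by rewrite !inE eqxx.
apply/exists_inP; exists z; first by rewrite !inE eqxx.
apply/exists_inP; exists y; first by rewrite !inE eqxx orbT.
apply/exists_inP; exists w; first by rewrite !inE eqxx orbT.
by rewrite xz zy yw.
Qed.

Lemma triangulating_max P : triangulating n P -> maxset (@noncrossing n) (chord_set P).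
Proof.
move=> pP; apply/maxsetP; split; first exact: triangulating_noncrossing.
move=> D /andP[/forall_inP D2 /forall_inP ncD] sub; apply/eqP; rewrite eqEsubset sub andbT.
apply/subsetP => c cD.
have [x [y [xy e]]] := chord_pair (eqP (D2 _ cD)); subst c.
rewrite mem_chord_set //; apply/negPn/negP => nP.
have xy1 : x.+1 < y.
  rewrite ltn_neqAle xy andbT; apply: contra nP => /eqP <-.
  by apply: (chord_side pP); have := ltn_ord y; lia.
have [i [j [Pij H]]] := chord_cover pP xy1 (ltn_ord y) nP.
have /andP[ij jn] := chord_lt pP Pij.
have [i' ei] : exists i' : 'I_n.+1, i' = i :> nat.
  have lt : i < n.+1 by lia.
  by exists (Ordinal lt).
have [j' ej] : exists j' : 'I_n.+1, j' = j :> nat by exists (Ordinal (jn : j < n.+1)).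
rewrite -ei -ej in Pij H.
have dD : [set i'; j'] \in D.
  by apply: (subsetP sub); apply/chord_setP; exists i', j'.
case: H => -[h1 h2 h3].
- have /forall_inP/(_ _ dD)/negP := ncD _ cD; apply; exact: crosses_pair.
- have /forall_inP/(_ _ cD)/negP := ncD _ dD; apply; exact: crosses_pair.
Qed.

Definition chords_of (D : {set {set 'I_n.+1}}) : rel nat := fun x y =>
  [exists i : 'I_n.+1, exists j : 'I_n.+1,
    [&& i == x :> nat, j == y :> nat, x < y & [set i; j] \in D]].

Lemma chords_ofP (D : {set {set 'I_n.+1}}) x y : chords_of D x y ->
  exists i j, [/\ i = x :> nat, j = y :> nat, x < y & [set i; j] \in D].
Proof.
by case/existsP=> i /existsP[j /and4P[/eqP ? /eqP ? ? ?]]; exists i, j.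
Qed.

Lemma mem_chords_of (D : {set {set 'I_n.+1}}) i j : i < j -> [set i; j] \in D -> chords_of D i j.
Proof.
by move=> ij ijD; apply/existsP; exists i; apply/existsP; exists j; rewrite !eqxx ij ijD.
Qed.

(** A chord [{i, j}] of a maximal noncrossing set splits at the last [k < j] joined to
    [i]: a chord crossing [{k, j}] would cross [{i, j}] or [{i, k}], or would join [i]
    to a vertex between [k] and [j]. *)
Lemma triangulating_chords_of D : 2 <= n -> maxset (@noncrossing n) D -> triangulating n (chords_of D).
Proof.
move=> n2 maxD; have PI := @chords_ofP D; have PE := @mem_chords_of D.
split.
- by move=> x y /PI[i [j [<- <- ij _]]]; rewrite ij -ltnS ltn_ord.
- by apply: (PE ord0 ord_max); [rewrite /=; lia | rewrite setUC; apply: (side_chord n2 maxD); right].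
- move=> i lti; have lti' : i < n.+1 by lia.
  apply: (PE (Ordinal lti') (Ordinal (lti : i.+1 < n.+1))) => //.
  by apply: (side_chord n2 maxD); left.
- move=> x y /PI[i [j [<- <- ij ijD]]] ij1.
  pose Q k := [&& i < k, k < j & [set i; k] \in D].
  have lt : i.+1 < n.+1 by have := ltn_ord j; lia.
  have Q0 : Q (Ordinal lt).
    by rewrite /Q /= ltnSn ij1 /=; apply: (side_chord n2 maxD); left.
  case: (arg_maxnP (@nat_of_ord n.+1) Q0) => k /and3P[ik kj ikD] kmax.
  exists k; first exact: PE.
  apply: PE => //; apply: (chord_max n2 maxD kj) => z w zwD zw.
  have N1 := noncrossing_pair maxD ijD zwD; have N2 := noncrossing_pair maxD zwD ijD.
  have N3 := noncrossing_pair maxD ikD zwD.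
  split=> -[h1 h2 h3]; first by apply: N1; split; lia.
  case: (ltngtP z i) => zi.
  + by apply: N2; split; lia.
  + by apply: N3; split; lia.
  + have e : z = i by apply: val_inj.
    subst z; have := kmax w; rewrite /Q zwD andbT zw h3 => /(_ isT); lia.
- move=> x y z w /PI[i [j [<- <- ij ijD]]] /PI[k [l [<- <- kl klD]]].
  exact: (noncrossing_pair maxD ijD klD).
Qed.

Lemma triangleP P (t : {set 'I_n.+1}) : triangulating n P ->
  reflect (exists i j k, [/\ P i j, P j k, P i k & t = [set i; j; k]])
    (t \in triangles_of (chord_set P)).
Proof.
move=> pP; rewrite inE; apply: (iffP andP).
- case=> t3 /forallP sub.
  have subP (c : {set 'I_n.+1}) : #|c| = 2 -> c \subset t -> c \in chord_set P.
    by move=> c2 ct; have := sub c; rewrite c2 eqxx ct.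
  have [i it] : exists i, i \in t by apply/set0Pn; rewrite -card_gt0 (eqP t3).
  pose i0 := [arg min_(x < i in t) (x : nat)]; pose k0 := [arg max_(x > i in t) (x : nat)].
  have [ti min] : i0 \in t /\ forall x, x \in t -> i0 <= x.
    by rewrite /i0; case: arg_minnP.
  have [tk max] : k0 \in t /\ forall x, x \in t -> x <= k0.
    by rewrite /k0; case: arg_maxnP.
  have [j] : exists j, j \in t :\: [set i0; k0].
    apply/set0Pn; rewrite -card_gt0 cardsD (eqP t3) subn_gt0.
    apply: leq_ltn_trans (subset_leq_card (subsetIr _ _)) _.
    by rewrite cards2; case: (_ != _).
  rewrite !inE negb_or -!val_eqE /= => /andP[/andP[ji jk] tj].
  have lij : i0 < j by have := min _ tj; rewrite leq_eqVlt eq_sym (negPf ji).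
  have ljk : j < k0 by have := max _ tj; rewrite leq_eqVlt (negPf jk).
  have lik := ltn_trans lij ljk.
  have H (x y : 'I_n.+1) : x < y -> x \in t -> y \in t -> P x y.
    move=> xy xt yt; rewrite -(mem_chord_set pP xy); apply: subP.
      by rewrite cards2 -val_eqE /=; case: eqP xy => //= ->; rewrite ltnn.
    by rewrite subUset !sub1set xt yt.
  exists i0, j, k0; split; try exact: H.
  apply/esym/eqP; rewrite eqEcard !subUset !sub1set ti tj tk /= (eqP t3).
  rewrite -setUA cardsU1 cards2 !inE -!val_eqE /=.
  by rewrite (ltn_eqF lij) (ltn_eqF ljk) (ltn_eqF lik).
- case=> i [j [k [Pij Pjk Pik ->]]].
  have /andP[lij _] := chord_lt pP Pij; have /andP[ljk _] := chord_lt pP Pjk.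
  have lik := ltn_trans lij ljk.
  rewrite -setUA cardsU1 cards2 !inE -!val_eqE /=.
  rewrite (ltn_eqF lij) (ltn_eqF ljk) (ltn_eqF lik); split=> //.
  apply/forallP => c; apply/implyP => /andP[/eqP/chord_pair[x [y [xy ->]]]].
  rewrite mem_chord_set // subUset !sub1set !inE.
  by move=> /andP[/or3P[]/eqP? /or3P[]/eqP?]; subst => //; move: xy; lia.
Qed.

Definition triangulation_of P (n2 : 2 <= n) (pP : triangulating n P) : triangulation n :=
  Triangulation n2 (ex_intro2 _ _ (chord_set P) (triangulating_max pP) erefl).

End ToSets.

(** * Polygons labelled by edges *)

Section Labels.
Variable X : symset.

(** The vertex labels [V] make the endpoint conditions local: without them they
    would have to be recovered from the triangles by induction. *)
Record labelled (P : rel nat) (V : nat -> X 0) (E : nat -> nat -> X 1) : Prop := Labelled {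
  label_src : forall i j, P i j -> src (E i j) = V i;
  label_tgt : forall i j, P i j -> tgt (E i j) = V j;
  label_tri : forall i k j, P i k -> P k j -> P i j -> tri (E i k) (E k j) (E i j)
}.

Lemma labelled_comp P V E (g : nat -> nat) : labelled P V E ->
  labelled (fun i j => P (g i) (g j)) (fun i => V (g i)) (fun i j => E (g i) (g j)).
Proof. by case=> h1 h2 h3; split=> *; [apply: h1 | apply: h2 | apply: h3]. Qed.

Definition insert_vertex (V : nat -> X 0) h (v : X 0) : nat -> X 0 :=
  fun i => if i == h then v else V (unbump h i).

Definition insert_edges (E : nat -> nat -> X 1) h (a b : X 1) : nat -> nat -> X 1 :=
  fun i j => if i == h then b else if j == h then a else E (unbump h i) (unbump h j).

Lemma labelled_insert n P V E h a b : triangulating n P -> h < n ->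
  labelled P V E -> tri a b (E h h.+1) ->
  labelled (insert_chords P h.+1) (insert_vertex V h.+1 (tgt a)) (insert_edges E h.+1 a b).
Proof.
move=> pP hn [srcE tgtE triE] t; have [ea eab eb] := tri_ends t.
have pP' : triangulating n.+1 (insert_chords P h.+1) by apply: triangulating_insert.
have Ph : P h h.+1 by exact: chord_side pP _ hn.
have ne i : (bump h.+1 i == h.+1) = false by case: (bumpE h.+1 i) => -[? ->]; lia.
have VO i : insert_vertex V h.+1 (tgt a) (bump h.+1 i) = V i.
  by rewrite /insert_vertex ne bumpK.
have VI : insert_vertex V h.+1 (tgt a) h.+1 = tgt a by rewrite /insert_vertex eqxx.
have EO i j : insert_edges E h.+1 a b (bump h.+1 i) (bump h.+1 j) = E i j.
  by rewrite /insert_edges !ne !bumpK.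
have EL j : insert_edges E h.+1 a b h.+1 j = b by rewrite /insert_edges eqxx.
have ER : insert_edges E h.+1 a b h h.+1 = a.
  by rewrite /insert_edges eqxx; case: eqP => //; lia.
have bh : bump h.+1 h = h by rewrite bump_id.
have bh1 : bump h.+1 h.+1 = h.+2 by rewrite bump_up.
have := (VO h, VO h.+1, EO h h.+1); rewrite bh bh1 => -[[VH VH1] EH].
split.
- move=> i j /insertP[|k [->]|k l Pkl]; first by rewrite EL VI eab.
    by rewrite ER ea srcE // VH.
  by rewrite EO VO srcE.
- move=> i j /insertP[|k [->]|k l Pkl]; first by rewrite EL VH1 eb tgtE.
    by rewrite ER VI.
  by rewrite EO VO tgtE.
- move=> i k j.
  have [-> | /bump_surj[k' ->]] := eqVneq k h.+1.
    rewrite insert_at_r insert_at_l => /eqP[->] /eqP-> _.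
    by rewrite ER EL EH.
  have [-> | /bump_surj[i' ->]] := eqVneq i h.+1.
    by rewrite !insert_at_l => /eqP-> /(chord_lt pP') + /eqP; lia.
  have [-> | /bump_surj[j' ->]] := eqVneq j h.+1.
    by rewrite !insert_at_r => /(chord_lt pP') + /eqP[+] /eqP[]; lia.
  by rewrite !insert_bump !EO; exact: triE.
Qed.

(** Each expansion step glues one ear on the labelled polygon built so far. *)
Lemma expands_labelled (e : X 1) w : expands [:: e] w -> exists P V E,
  [/\ triangulating (size w) P, labelled P V E, E 0 (size w) = e
    & forall i, i < size w -> E i i.+1 = nth e w i].
Proof.
elim=> [|l a b c r _ [P [V [E [pP lE E0 Ew]]]] t].
  exists (fun i j => (i == 0) && (j == 1)), (fun i => if i == 0 then src e else tgt e).
  exists (fun _ _ => e); split=> //; last by case.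
    split=> //.
    - by move=> i j /andP[/eqP-> /eqP->].
    - by case.
    - by move=> i j /andP[/eqP-> /eqP->].
    - by move=> x y z w' /andP[/eqP-> /eqP->] /andP[/eqP-> /eqP->] [].
  split=> [i j /andP[/eqP-> _] | i j /andP[_ /eqP->] | i k j /andP[_ /eqP->]] //.
have sz : size (l ++ a :: b :: r) = (size (l ++ c :: r)).+1 by rewrite !size_cat /= !addnS.
have hn : size l < size (l ++ c :: r) by rewrite size_cat /=; lia.
have Ec : E (size l) (size l).+1 = c by rewrite Ew // nth_cat ltnn subnn.
exists (insert_chords P (size l).+1), (insert_vertex V (size l).+1 (tgt a)).
exists (insert_edges E (size l).+1 a b); rewrite sz; split.
- exact: triangulating_insert.
- by apply: (labelled_insert pP) => //; rewrite Ec.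
- rewrite /insert_edges; case: eqP; first by lia.
  by move=> _; case: eqP; [lia | move=> _; rewrite -[in RHS]E0 /unbump /=; congr E; lia].
- move=> i lti; rewrite /insert_edges nth_cat eqSS.
  case: (ltngtP i (size l)) => il.
  + case: eqP => [|_]; first by lia.
    rewrite !unbump_id ?Ew; try lia.
    by rewrite nth_cat il.
  + case: eqP => [-> | il']; first by rewrite subSnn.
    rewrite !unbump_up; try lia.
    rewrite -[i.+1.-1]prednK ?Ew; try lia.
    rewrite nth_cat; case: ltnP; first by lia.
    have [d ->] : exists d, i = d + (size l).+2 by exists (i - (size l).+2); lia.
    by move=> _; rewrite !addnS /= !subSn ?addnK //; lia.
  + by rewrite il subnn; case: eqP => //; lia.
Qed.

Hypothesis spX : spiny X.

(** In a spiny symmetric set a cell is unique once its edges are prescribed, so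
    that compatible cells on the members of [C] automatically assemble into a
    natural map. *)
Lemma hom_of_edges n (C : {set {set 'I_n.+1}}) (L : 'I_n.+1 -> 'I_n.+1 -> X 1) :
  (forall c, c \in C -> exists k (s : X k) (b : 'I_k.+1 -> 'I_n.+1),
     (forall i, i \in c -> exists j, b j = i) /\
     (forall i j, edge i j s = L (b i) (b j))) ->
  exists h : hom (carried C) X, forall m (f : carried C m) i j,
    edge i j (h m f) = L (sval f i) (sval f j).
Proof.
move=> HC.
have ex m (f : carried C m) : exists x : X m, forall i j, edge i j x = L (sval f i) (sval f j).
  have /exists_inP[c /HC[k [s [b [bc sL]]]] /forallP fc] := svalP f.
  have [a ab] := choice (fun i => bc _ (fc i)).
  by exists (act a s) => i j; rewrite edge_act sL !ab.
have nat l m (a : 'I_l.+1 -> 'I_m.+1) (f : carried C m) :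
    projT1 (cid (ex l (act a f))) = act a (projT1 (cid (ex m f))).
  apply: cell_ext => // i j; rewrite edge_act.
  by rewrite (projT2 (cid (ex l (act a f)))) (projT2 (cid (ex m f))).
exists (Hom nat) => m f i j; exact: (projT2 (cid (ex m f))).
Qed.

(** The labels of all ordered pairs of vertices, among them the reversed and the
    degenerate edges. *)
Definition full_label (V : nat -> X 0) (E : nat -> nat -> X 1) (i j : nat) : X 1 :=
  if i < j then E i j else if j < i then inv_edge (E j i) else id_edge (V i).

Lemma labelled_hom n P V E (n2 : 2 <= n) (pP : triangulating n P) : labelled P V E ->
  exists h : hom (H_tri (triangulation_of n2 pP)) X,
    forall m (f : H_tri (triangulation_of n2 pP) m) i j,
      edge i j (h m f) = full_label V E (sval f i) (sval f j).
Proof.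
move=> [srcE tgtE triE].
apply: (@hom_of_edges n _ (fun i j => full_label V E i j)) => c.
case/(triangleP _ pP) => i [j [k [Pij Pjk Pik ->]]].
have [s [s01 s12 s02]] := triE _ _ _ Pij Pjk Pik.
exists 2, s, (tuple_map i j k); split.
  move=> x; rewrite !inE => /orP[/orP[]|]/eqP->;
    [exists (inord 0) | exists (inord 1) | exists (inord 2)];
    by rewrite /tuple_map inordK.
have /andP[lij _] := chord_lt pP Pij; have /andP[ljk _] := chord_lt pP Pjk.
have lik := ltn_trans lij ljk.
have v0 : vertex (inord 0) s = V i by rewrite -(src_edge _ (inord 1)) s01 srcE.
have v1 : vertex (inord 1) s = V j by rewrite -(src_edge _ (inord 2)) s12 srcE.
have v2 : vertex (inord 2) s = V k by rewrite -(tgt_edge (inord 1)) s12 tgtE.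
have s10 : edge (inord 1) (inord 0) s = inv_edge (E i j) by rewrite -s01 inv_edgeE.
have s21 : edge (inord 2) (inord 1) s = inv_edge (E j k) by rewrite -s12 inv_edgeE.
have s20 : edge (inord 2) (inord 0) s = inv_edge (E i k) by rewrite -s02 inv_edgeE.
have I3 (x : 'I_3) : [\/ x = inord 0, x = inord 1 | x = inord 2].
  case: x => [[|[|[|//]]] lt]; [constructor 1 | constructor 2 | constructor 3];
    by apply: val_inj; rewrite /= inordK.
have lji : (j < i) = false by lia. have lkj : (k < j) = false by lia.
have lki : (k < i) = false by lia.
move=> x y; case: (I3 x) => ->; case: (I3 y) => ->;
  rewrite /full_label /tuple_map !inordK //= ?ltnn ?lij ?ljk ?lik ?lji ?lkj ?lki //.
- by rewrite edge_diag v0.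
- by rewrite edge_diag v1.
- by rewrite edge_diag v2.
Qed.

End Labels.

(** * Triangulations without a common ear *)

Definition adjacent (n x y : nat) : bool :=
  [|| x == y, x.+1 == y, y.+1 == x, (x == 0) && (y == n) | (x == n) && (y == 0)].

Lemma adjacent_sym n x y : adjacent n x y = adjacent n y x.
Proof. by rewrite /adjacent; lia. Qed.

Lemma adjacentP n (x y : 'I_n.+1) : 2 <= n ->
  reflect (exists2 c, c \in circular_spine_sets n & (x \in c) && (y \in c))
    (adjacent n x y).
Proof.
move=> n2.
have S (a b : 'I_n.+1) : a.+1 = b -> [set a; b] \in circular_spine_sets n.
  move=> ab; rewrite !inE; apply/orP; right.
  have an : a < n by have := ltn_ord b; lia.
  apply/imsetP; exists (Ordinal an) => //.
  by congr [set _; _]; apply: val_inj; rewrite //= /bump /= -ab.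
have S0 : [set ord0; ord_max] \in circular_spine_sets n by rewrite !inE eqxx.
apply: (iffP idP) => [xy | [c]].
  case: (eqVneq (x : nat) y) => [/val_inj-> | nxy].
    have [yn | yn] := ltnP y n.
      exists [set y; Ordinal (yn : y.+1 < n.+1)]; last by rewrite !inE eqxx.
      exact: S.
    exists [set ord0; ord_max] => //.
    by rewrite !inE -!val_eqE /=; have := ltn_ord y; lia.
  have [/S ? | /S ? | h] : [\/ x.+1 = y, y.+1 = x | ((x == 0 :> nat) && (y == n :> nat)) ||
      ((x == n :> nat) && (y == 0 :> nat))].
    move: xy; rewrite /adjacent (negPf nxy) /=.
    by move=> /or3P[/eqP|/eqP|]; [constructor 1 | constructor 2 | constructor 3].
  - by exists [set x; y]; rewrite // !inE !eqxx orbT.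
  - by exists [set y; x]; rewrite // !inE !eqxx orbT.
  - exists [set ord0; ord_max] => //.
    by rewrite !inE -!val_eqE /=; move: h; lia.
rewrite !inE => /orP[/eqP-> | /imsetP[i _ ->]]; rewrite !inE -!val_eqE /= /bump /=;
  rewrite /adjacent; lia.
Qed.

Lemma step_const m (Q : pred 'I_m.+1) :
  (forall i : 'I_m, Q (widen_ord (leqnSn m) i) = Q (lift ord0 i)) -> forall i, Q i = Q ord0.
Proof.
move=> step [k km]; elim: k km => [|k IH] km; first by congr Q; apply: val_inj.
rewrite -(IH (ltnW km)); have := step (Ordinal (km : k < m)).
have -> : widen_ord (leqnSn m) (Ordinal (km : k < m)) = Ordinal (ltnW km) by apply: val_inj.
by have -> : lift ord0 (Ordinal (km : k < m)) = Ordinal km by apply: val_inj.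
Qed.

Lemma sorted_eq (p k q p' k' q' : nat) : p < k -> k < q -> p' < k' -> k' < q' ->
  (p == p') || (p == k') || (p == q') -> (k == p') || (k == k') || (k == q') ->
  (q == p') || (q == k') || (q == q') -> p = p' /\ k = k' /\ q = q'.
Proof. lia. Qed.

(** A triangle none of whose corners is isolated for adjacency has two sides of
    the polygon among its edges, hence is an ear, at an inner vertex, at [0] or at
    [n]. *)
Lemma adjacent_ear (n p k q : nat) : p < k -> k < q -> q <= n ->
  adjacent n p k || adjacent n p q -> adjacent n k p || adjacent n k q ->
  adjacent n q p || adjacent n q k ->
  [\/ k = p.+1 /\ q = k.+1, [/\ p = 0, k = 1 & q = n] | [/\ p = 0, k = n.-1 & q = n]].
Proof.
rewrite /adjacent => pk kq qn ap ak aq.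
have [h1|h1] := boolP ((k == p.+1) && (q == k.+1)).
  by constructor 1; case/andP: h1 => /eqP-> /eqP->.
have [h2|h2] := boolP ((p == 0) && (q == n)); last by lia.
by have [h3|h3] := boolP (k == 1); [constructor 2 | constructor 3]; split; lia.
Qed.

Section WellBehaved.
Variables (n : nat) (n2 : 2 <= n) (P P' : rel nat).
Hypotheses (pP : triangulating n P) (pP' : triangulating n P').

Let T := triangulation_of n2 pP.
Let T' := triangulation_of n2 pP'.

Hypothesis no_ear : forall h, h <= n -> ear n P h -> ear n P' h -> False.

(** Assume that the values of [f], which move along sides of the polygon, lie in a
    triangle of both triangulations.  If [f] misses a corner of the first triangle,
    its image lies in a side.  Otherwise the two triangles coincide, and [f] can
    reach each corner only along a side, so the common triangle is a common
    ear. *)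
Lemma in_circular m (f : 'I_m.+1 -> 'I_n.+1) :
  in_some T f -> in_some T' f ->
  (forall i : 'I_m, in_some (circular_spine_sets n)
     (fun k => f (pair_map (widen_ord (leqnSn m) i) (lift ord0 i) k))) ->
  in_some (circular_spine_sets n) f.
Proof.
move=> /exists_inP[t tT /forallP ft] /exists_inP[t' tT' /forallP ft'] fe.
have adj (i : 'I_m) : adjacent n (f (widen_ord (leqnSn m) i)) (f (lift ord0 i)).
  apply/adjacentP => //; have /exists_inP[c cC /forallP fc] := fe i.
  by exists c => //; rewrite (fc ord0) (fc ord_max).
have two (x y : 'I_n.+1) : adjacent n x y -> (forall i, f i = x \/ f i = y) ->
    in_some (circular_spine_sets n) f.
  move=> /(adjacentP _ _ n2)[c cC /andP[xc yc]] fxy; apply/exists_inP; exists c => //.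
  by apply/forallP => i; case: (fxy i) => ->.
(* [f] is constant at [v], misses [v], or steps to or from [v] along a side *)
have alt v : [\/ forall i, f i = v, forall i, f i <> v |
    exists i j, [/\ f i <> v, f j = v & adjacent n (f i) v]].
  case: (pselect (forall i, (f i == v) = (f ord0 == v))) => H.
    case: (eqVneq (f ord0) v) => h0; [constructor 1 | constructor 2] => i; apply/eqP;
      by rewrite H // h0.
  constructor 3; apply: contrapT => nex; apply: H.
  apply: (@step_const _ (fun i => f i == v)) => i; apply/eqP/eqP => h.
    apply: contrapT => h'; apply: nex; exists (lift ord0 i), (widen_ord (leqnSn m) i).
    by split=> //; rewrite -h adjacent_sym; exact: adj.
  apply: contrapT => h'; apply: nex; exists (widen_ord (leqnSn m) i), (lift ord0 i).
  by split=> //; rewrite -h; exact: adj.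
move: tT => /(triangleP _ pP)[p [k [q [Ppk Pkq Ppq et]]]].
move: tT' => /(triangleP _ pP')[p' [k' [q' [Ppk' Pkq' Ppq' et']]]].
have f3 i : [\/ f i = p, f i = k | f i = q].
  by have := ft i; rewrite et !inE => /orP[/orP[]|]/eqP->;
    [constructor 1 | constructor 2 | constructor 3].
have refl x : adjacent n x x by rewrite /adjacent eqxx.
(* if [f] takes values among [x] and [y] only, it is constant or joins them by a side *)
have omit x y z : (forall i, [\/ f i = x, f i = y | f i = z]) -> (forall i, f i <> z) ->
    in_some (circular_spine_sets n) f.
  move=> fxyz fz; have fxy i : f i = x \/ f i = y.
    by case: (fxyz i) (fz i) => ->; [left | right | ].
  case: (alt x) => [fx | fx | [i [j [h1 h2 h3]]]].
  - by apply: (two x x) => // i; left.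
  - by apply: (two y y) => // i; case: (fxy i) (fx i) => ->; auto.
  - apply: (two (f i) x) => // l; have [//|fi] := fxy i.
    by rewrite fi; case: (fxy l); auto.
case: (alt p) => [fp | fp | [ip [jp [hp1 hp2 hp3]]]].
- by apply: (two p p) => // i; left.
- by apply: (omit k q p) => // i; case: (f3 i) => ->; [constructor 3 | constructor 1 | constructor 2].
case: (alt k) => [fk | fk | [ik [jk [hk1 hk2 hk3]]]].
- by apply: (two k k) => // i; left.
- by apply: (omit p q k) => // i; case: (f3 i) => ->; [constructor 1 | constructor 3 | constructor 2].
case: (alt q) => [fq | fq | [iq [jq [hq1 hq2 hq3]]]].
- by apply: (two q q) => // i; left.
- by apply: (omit p k q).
have tp : p \in t' by rewrite -hp2.
have tk : k \in t' by rewrite -hk2.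
have tq : q \in t' by rewrite -hq2.
have lpk := chord_lt pP Ppk; have lkq := chord_lt pP Pkq.
have lpk' := chord_lt pP' Ppk'; have lkq' := chord_lt pP' Pkq'.
have [ep [ek eq]] : p = p' /\ k = k' /\ q = q'.
  move: tp tk tq; rewrite et' !inE -!val_eqE /= => tp tk tq.
  have [] := sorted_eq (andP lpk).1 (andP lkq).1 (andP lpk').1 (andP lkq').1 tp tk tq.
  by move=> /val_inj ? [/val_inj ? /val_inj ?].
subst p' k' q'.
have ap : adjacent n p k || adjacent n p q.
  by case: (f3 ip) hp1 hp3 => -> // _; rewrite adjacent_sym => ->; rewrite ?orbT.
have ak : adjacent n k p || adjacent n k q.
  by case: (f3 ik) hk1 hk3 => -> // _; rewrite adjacent_sym => ->; rewrite ?orbT.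
have aq : adjacent n q p || adjacent n q k.
  by case: (f3 iq) hq1 hq3 => -> // _; rewrite adjacent_sym => ->; rewrite ?orbT.
have [] := adjacent_ear (andP lpk).1 (andP lkq).1 (ltn_ord q) ap ak aq.
- move=> [kp qk]; case: (no_ear (h := k)); first by rewrite -ltnS ltn_ord.
    by rewrite /ear kp /= -kp -qk (ltn_eqF (leq_trans (andP lkq).1 (ltn_ord q))).
  by rewrite /ear kp /= -kp -qk (ltn_eqF (leq_trans (andP lkq).1 (ltn_ord q))).
- by move=> [_ k1 qn]; move: Pkq Pkq'; rewrite k1 qn => h h'; case: (@no_ear 0).
- have n0 : (n == 0) = false by case: (n) n2.
  move=> [p0 kn _]; move: Ppk Ppk'; rewrite p0 kn => h h'.
  by case: (@no_ear n); rewrite /ear ?n0 ?eqxx.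
Qed.

(** Two cells of the pushout with the same spine come from the same function; if
    they lie on different sides, then all their principal edges are in the
    circular spine, and [in_circular] shows that the function itself is, so that
    the two cells are glued. *)
Lemma no_ear_well_behaved : well_behaved T T'.
Proof.
move=> m m1 x y; rewrite -[x]repK -[y]repK.
move: (rep x) (rep y) => u v {x y} uv.
pose a (i : 'I_m) := pair_map (widen_ord (leqnSn m) i) (lift ord0 i).
have uva i : class (@po_rel _ _ _ (cSp_H T) (cSp_H T') 1) (po_act0 (a i) u) =
    class (@po_rel _ _ _ (cSp_H T) (cSp_H T') 1) (po_act0 (a i) v).
  by rewrite -!po_actE; exact: (f_equal (fun w => w i) uv).
have val_act k l (b : 'I_k.+1 -> 'I_l.+1) w : @po_val _ T T' k (po_act0 b w) = po_val w \o b.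
  by case: w.
have e : po_val u = po_val v.
  have ea i k : po_val u (a i k) = po_val v (a i k).
    have : po_val (po_act0 (a i) u) = po_val (po_act0 (a i) v).
      by case/glued_A: (uva i) => [-> | []].
    by rewrite !val_act => /(f_equal (fun w => w k)).
  apply/funext => -[[|k] km].
    have := ea (Ordinal m1) ord0; rewrite /a /pair_map /=.
    by rewrite (_ : widen_ord _ _ = Ordinal km) //; apply: val_inj.
  have := ea (Ordinal (km : k < m)) ord_max; rewrite /a /pair_map /=.
  by rewrite (_ : lift _ _ = Ordinal km) //; apply: val_inj.
have mixed (f : H_tri T m) (g : H_tri T' m) : sval f = sval g ->
    (forall i, in_some (circular_spine_sets n) (fun k => sval f (a i k))) ->
    class (@po_rel _ _ _ (cSp_H T) (cSp_H T') m) (inl f) =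
    class (@po_rel _ _ _ (cSp_H T) (cSp_H T') m) (inr g).
  move=> fg fa; have fc : in_some (circular_spine_sets n) (sval f).
    by apply: in_circular fa; [exact: (svalP f) | rewrite fg; exact: (svalP g)].
  apply: class_eq; exists (exist _ (sval f) fc : cSp n m).
  by split; congr (_ _); apply: carried_inj.
have {uv}uva i := glued_A (uva i).
case: u v uva e => [f|f] [g|g] /= uva e.
- by rewrite (carried_inj e).
- by apply: mixed => // i; case: (uva i) => [//|[]].
- apply/esym; apply: mixed => // i; rewrite -e.
  by case: (uva i) => [//|[]].
- by rewrite (carried_inj e).
Qed.

End WellBehaved.

(** * From orthogonality to embeddability *)

Section Orthogonal.
Variable X : partial_groupoid.
Hypothesis orthX : forall (n : nat) (T T' : triangulation n) (wb : well_behaved T T'),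
  @orthogonal X (NA_pg wb) (A_pg wb) (NA_to_A T T').

Let spX : spiny X := @pg_spiny X.

Definition agree n (E E' : nat -> nat -> X 1) : Prop :=
  forall i, i < n -> E i i.+1 = E' i i.+1.

(** The two labellings define a map on [NA]; since it extends to [A], where the
    long sides of the two triangulations are identified, it takes the same value
    on both long sides. *)
Lemma root_unique_wb n P P' V V' E E' (n2 : 2 <= n) (pP : triangulating n P) (pP' : triangulating n P') :
  well_behaved (triangulation_of n2 pP) (triangulation_of n2 pP') ->
  labelled P V E -> labelled P' V' E' -> agree n E E' -> E 0 n = E' 0 n.
Proof.
move=> wb lE lE' eqE.
have [k kE] := labelled_hom spX n2 pP lE; have [k' kE'] := labelled_hom spX n2 pP' lE'.
have eqV i : i <= n -> V i = V' i.
  rewrite leq_eqVlt => /orP[/eqP-> | lti].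
    have lti : n.-1 < n by lia.
    have := eqE _ lti; have := chord_side pP lti; have := chord_side pP' lti.
    rewrite prednK; last by lia.
    by move=> h' h e; rewrite -(label_tgt lE h) -(label_tgt lE' h') e.
  rewrite -(label_src lE (chord_side pP lti)) -(label_src lE' (chord_side pP' lti)).
  by rewrite eqE.
have full_eq c (i j : 'I_n.+1) : c \in spine_sets n -> i \in c -> j \in c ->
    full_label V E i j = full_label V' E' i j.
  move=> /imsetP[x _ ->]; rewrite !inE -!val_eqE /= /bump /= add1n => hi hj.
  have xn := ltn_ord x; rewrite /full_label.
  by move: hi hj => /orP[]/eqP-> /orP[]/eqP->; rewrite ?ltnn ?ltnSn ?ltnNge ?leqnSn /= ?eqE ?eqV // ltnW.
have gE : hcomp k (Sp_H (triangulation_of n2 pP)) =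
          hcomp k' (Sp_H (triangulation_of n2 pP')).
  apply: hom_ext => m s; apply: cell_ext => // i j; rewrite /= kE kE' /=.
  by have /exists_inP[c cS /forallP sc] := svalP s; apply: full_eq cS _ _.
have [h [gh _]] := @orthX _ _ _ wb (po_desc gE).
pose T := triangulation_of n2 pP; pose T' := triangulation_of n2 pP'.
have zc : in_some (circular_spine_sets n) (pair_map (@ord0 n) ord_max).
  apply/exists_inP; exists [set ord0; ord_max]; first by rewrite !inE eqxx.
  by apply/forallP => i; rewrite /pair_map !inE; case: ifP; rewrite eqxx ?orbT.
pose z : cSp n 1 := exist (fun f => in_some (circular_spine_sets n) f) _ zc.
have ghE (u : (H_tri T 1 + H_tri T' 1)%type) :
    match u with inl b => k 1 b | inr c => k' 1 c end =
    h 1 (class (@po_rel _ _ _ (cSp_H T) (cSp_H T') 1) u).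
  rewrite -NA_to_A_class -(po_desc_cellE gE).
  exact: (f_equal (fun f : hom (NA_pg wb) X => f 1 (class _ u)) gh).
have kk : k 1 (cSp_H T 1 z) = k' 1 (cSp_H T' 1 z).
  rewrite (ghE (inl _)) (ghE (inr _)); congr (h 1 _).
  exact: (f_equal (fun f : hom (cSp n) (A_symset T T') => f 1 z) (po_comm (cSp_H T) (cSp_H T'))).
have := kE _ (cSp_H T 1 z) ord0 ord_max; rewrite kk kE' /= /full_label /pair_map /=.
by rewrite (leq_trans _ n2).
Qed.

(** By induction on the number of vertices.  A common ear is cut off; spininess
    makes the third sides of its two copies agree whenever two of their sides do,
    which restores the agreement of the spines if the tip is an inner vertex, and
    otherwise transfers the equality of long sides back.  Without a common ear the
    pair is well-behaved. *)
Lemma root_unique n P P' V V' E E' : triangulating n P -> triangulating n P' ->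
  labelled P V E -> labelled P' V' E' -> agree n E E' -> E 0 n = E' 0 n.
Proof.
elim: n P P' V V' E E' => [|[|n] IH] P P' V V' E E' pP pP' lE lE' eqE.
- by have := chord_lt pP (chord_root pP).
- exact: eqE.
case: (pselect (exists h, [/\ h <= n.+2, ear n.+2 P h & ear n.+2 P' h])); last first.
  move=> no_ear; have n2 : 2 <= n.+2 by [].
  apply: (@root_unique_wb _ P P' V V' E E' n2 pP pP') => //.
  by apply: no_ear_well_behaved => h *; apply: no_ear; exists h.
move=> [h [hn eh eh']].
have third i k j : P i k -> P k j -> P i j -> P' i k -> P' k j -> P' i j ->
    E i k = E' i k -> E k j = E' k j -> E i j = E' i j.
  move=> h1 h2 h3 h1' h2' h3' e1 e2; have := label_tri lE' h1' h2' h3'.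
  by rewrite -e1 -e2; exact: tri_unique (label_tri lE h1 h2 h3).
have IHh : agree n.+1 (fun i j => E (bump h i) (bump h j)) (fun i j => E' (bump h i) (bump h j)) ->
    E (bump h 0) (bump h n.+1) = E' (bump h 0) (bump h n.+1).
  exact: (IH _ _ _ _ _ _ (triangulating_remove _ pP hn eh) (triangulating_remove _ pP' hn eh')
             (labelled_comp _ lE) (labelled_comp _ lE')).
(* the long side is in the ear exactly when the tip is [0] or [n] *)
have [h0 | h0] := posnP h.
  subst h; have s01 := chord_side pP (ltn0Sn n.+1); have s01' := chord_side pP' (ltn0Sn n.+1).
  apply: (third 0 1 n.+2 s01 eh (chord_root pP) s01' eh' (chord_root pP') (eqE _ _)) => //.
  by apply: IHh => i lti; apply: eqE.
have [hN | hN] := eqVneq h n.+2.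
  subst h; move: eh eh'; rewrite /ear eqxx /= => eh eh'.
  have sN := chord_side pP (ltnSn n.+1); have sN' := chord_side pP' (ltnSn n.+1).
  apply: (third 0 n.+1 n.+2 eh sN (chord_root pP) eh' sN' (chord_root pP')); last exact: eqE.
  move: IHh; rewrite !bump_id //; apply=> i lti /=.
  by rewrite !bump_id ?eqE //; lia.
move: IHh; rewrite bump_id // bump_up; last by lia.
apply=> i lti /=; case: (ltngtP i.+1 h) => ih.
- by rewrite !bump_id ?eqE //; lia.
- by rewrite !bump_up ?eqE //; lia.
- have eP : P i i.+2 by move: eh; rewrite /ear -ih /= ih (negPf hN).
  have eP' : P' i i.+2 by move: eh'; rewrite /ear -ih /= ih (negPf hN).
  rewrite -ih bump_id // bump_up //.
  have lt1 : i < n.+2 by lia. have lt2 : i.+1 < n.+2 by lia.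
  have [s1 s1'] := (chord_side pP lt1, chord_side pP' lt1).
  have [s2 s2'] := (chord_side pP lt2, chord_side pP' lt2).
  exact: (third i i.+1 i.+2 s1 s2 eP s1' s2' eP' (eqE _ lt1) (eqE _ lt2)).
Qed.

Lemma joinable_eq (e e' : X 1) : joinable [:: e] [:: e'] -> e = e'.
Proof.
case=> w /expands_labelled[P [V [E [pP lE <- Ew]]]] /expands_labelled[P' [V' [E' [pP' lE' <- Ew']]]].
apply: root_unique pP pP' lE lE' _ => i lti; rewrite Ew // Ew' //.
exact: set_nth_default.
Qed.

Lemma orthogonal_embeddable : embeddable X.
Proof.
suff inj m (x y : X m) : unit_map X m x = unit_map X m y -> x = y.
  move=> Z f g fg; apply: hom_ext => m z; apply: inj.
  exact: (f_equal (fun t : hom Z (nerve (tau X)) => t m z) fg).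
move=> xy; apply: cell_ext => // i j; apply: joinable_eq.
have h : arr (tau_edge i j x) = arr (tau_edge i j y).
  exact: (@gfunctor_congr (chaotic 'I_m.+1) (tau X) (unit_cell x) (unit_cell y) i j tt xy).
exact: joinable_tau_gen h.
Qed.

End Orthogonal.

(** * From embeddability to orthogonality *)

Section Embeddable.
Variable X : symset.

(** The right action of edges on arrows of [tau X], made total by sending a
    mismatch of endpoints to [None].  It evaluates a word by a plain [foldl], with
    no composability proofs to carry along. *)
Definition extend (o : option {p : tau X * tau X & ghom p.1 p.2}) (e : X 1) :
    option {p : tau X * tau X & ghom p.1 p.2} :=
  if o is Some (existT p f) then
    match pselect (src e = p.2) with
    | left h => Some (arr (gcomp f (tau_gen h erefl)))
    | right _ => None
    end
  else None.

Lemma extend_some (x y : tau X) (f : ghom x y) e z (p : src e = y) (q : tgt e = z) :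
  extend (Some (arr f)) e = Some (arr (gcomp f (tau_gen p q))).
Proof.
rewrite /extend /=; case: pselect => // h; congr Some.
apply: (@arr_comp (tau X) x y (tgt e) x y z f _ f) => //; exact: tau_gen_congr.
Qed.

Lemma extend_none (x y : tau X) (f : ghom x y) e :
  src e <> y -> extend (Some (arr f)) e = None.
Proof. by move=> ne; rewrite /extend /=; case: pselect. Qed.

Lemma extend_tri o a b c : tri a b c -> extend (extend o a) b = extend o c.
Proof.
case: o => [[[x y] f]|//] t.
have [eac eab ebc] := tri_ends t.
change (@ghom (tau X) x y) in f; rewrite -[existT _ _ _]/(arr f); case: (pselect (src c = y)) => [hc | hc]; last first.
  by rewrite !extend_none // eac.
have ha : src a = y by rewrite eac.
rewrite (extend_some f ha erefl) (extend_some _ (esym eab) ebc) (extend_some f hc erefl).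
congr Some; rewrite -gassoc; apply: arr_comp => //.
case: t eac eab ebc ha hc => s [<- <- <-] *.
rewrite -(@arr_comp _ _ _ _ _ _ _ (tau_edge (inord 0) (inord 1) s) (tau_edge (inord 1) (inord 2) s)).
- by rewrite tau_edge_comp; apply: tau_gen_congr.
- exact: tau_gen_congr.
- exact: tau_gen_congr.
Qed.

(** An edge of a nerve is determined by its arrow from [0] to [1], the others being
    its inverse and identities. *)
Lemma nerve_edge_ext (G : groupoid) (F H : gfunctor (chaotic 'I_2) G) :
  arr (@fmor _ _ F (@ord0 1) (@ord_max 1) tt) = arr (@fmor _ _ H (@ord0 1) (@ord_max 1) tt) ->
  F = H.
Proof.
move=> e.
have [e0 e1] : (F (@ord0 1), F (@ord_max 1)) = (H (@ord0 1), H (@ord_max 1)).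
  exact: (f_equal (@projT1 _ _) e).
have two (i : 'I_2) : i = ord0 \/ i = ord_max.
  by case: i => [[|[|//]] lt]; [left | right]; apply: val_inj.
have idE (i : chaotic 'I_2) : F i = H i -> arr (@fmor _ _ F i i tt) = arr (@fmor _ _ H i i tt).
  move=> ei; have := fmor_id F i; have := fmor_id H i.
  by rewrite -[gid i]/tt => -> ->; rewrite ei.
apply: gfunctor_ext => i j [].
case: (two i) => ->; case: (two j) => ->.
- exact: idE.
- exact: e.
- have := @fmor_inv _ _ F (@ord0 1) (@ord_max 1) tt.
  have := @fmor_inv _ _ H (@ord0 1) (@ord_max 1) tt.
  by rewrite -[ginv _]/tt => -> ->; exact: arr_inv.
- exact: idE.
Qed.

Lemma extend_inj (a b : X 1) : src a = src b ->
  extend (Some (arr (@gid (tau X) (src a)))) a = extend (Some (arr (@gid (tau X) (src a)))) b ->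
  unit_map X 1 a = unit_map X 1 b.
Proof.
move=> ab; rewrite (extend_some _ erefl erefl) (extend_some _ (esym ab) erefl) !gidl => /Some_inj h.
apply: nerve_edge_ext => /=.
transitivity (arr (tau_gen (erefl (src a)) (erefl (tgt a)))).
  by apply: tau_gen_congr; rewrite edge_full.
by rewrite h; apply: tau_gen_congr; rewrite edge_full.
Qed.

(** The image of a chord acts like the word of the spine edges below it, whatever
    the triangulation: split the chord and recurse. *)
Lemma extend_chord n (P : rel nat) (pP : triangulating n P) (C : {set {set 'I_n.+1}})
    (h : hom (carried C) X) (sp : nat -> X 1) : C = triangles_of (chord_set n P) ->
  (forall s : carried C 1, sval s ord_max = (sval s ord0).+1 :> nat ->
     h 1 s = sp (sval s ord0)) ->
  forall (s : carried C 1) o, P (sval s ord0) (sval s ord_max) ->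
    extend o (h 1 s) =
      foldl extend o [seq sp i | i <- iota (sval s ord0) (sval s ord_max - sval s ord0)].
Proof.
move=> eC hsp s o; have memC t : (t \in C) = (t \in triangles_of (chord_set n P)) by rewrite eC.
have [d le_d] := ubnP (sval s ord_max - sval s ord0).
elim: d s o le_d => // d IH s o le_d Ps.
have /andP[ls _] := chord_lt pP Ps.
case: (ltngtP (sval s ord0).+1 (sval s ord_max)) => [l1 | | l1]; [ | by lia | ]; last first.
  by rewrite -l1 subSnn /= hsp.
have [k Pk1 Pk2] := chord_split pP Ps l1.
have lk1 := chord_lt pP Pk1; have lk2 := chord_lt pP Pk2.
have [k' ek] : exists k' : 'I_n.+1, k = k'.
  by exists (Ordinal (n:=n.+1) (m:=k) ltac:(lia)).
subst k; rename k' into k.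
have tC : in_some C (tuple_map (sval s ord0) k (sval s ord_max)).
  apply/exists_inP; exists [set sval s ord0; k; sval s ord_max].
    by rewrite memC; apply/(triangleP _ pP); exists (sval s ord0), k, (sval s ord_max).
  by apply/forallP => i; rewrite /tuple_map !inE; case: ifP => _; [|case: ifP => _];
    rewrite eqxx ?orbT.
pose t : carried C 2 := exist (fun f => in_some C f) _ tC.
have ts : edge (inord 0) (inord 2) t = s.
  apply: carried_inj; apply/funext => i /=.
  rewrite /pair_map; case: eqP => [->|ni]; rewrite /tuple_map inordK //=.
  by congr (sval s _); apply: val_inj; case: i ni => [[|[|]]] //= lt []; apply: val_inj.
have htri : tri (h 1 (edge (inord 0) (inord 1) t)) (h 1 (edge (inord 1) (inord 2) t)) (h 1 s).
  by rewrite -ts /edge !hnat; exact: tri_cell.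
have e0 : sval (edge (inord 0) (inord 1) t) ord0 = sval s ord0.
  by rewrite /= /pair_map /tuple_map /= inordK.
have e1 : sval (edge (inord 0) (inord 1) t) ord_max = k.
  by rewrite /= /pair_map /tuple_map /= inordK.
have e2 : sval (edge (inord 1) (inord 2) t) ord0 = k.
  by rewrite /= /pair_map /tuple_map /= inordK.
have e3 : sval (edge (inord 1) (inord 2) t) ord_max = sval s ord_max.
  by rewrite /= /pair_map /tuple_map /= inordK.
rewrite -(extend_tri _ htri) (IH (edge (inord 0) (inord 1) t)) ?(IH (edge (inord 1) (inord 2) t));
  rewrite ?e0 ?e1 ?e2 ?e3 //; try lia.
rewrite -foldl_cat -map_cat; congr (foldl _ _ (map _ _)).
have -> : sval s ord_max - sval s ord0 = (k - sval s ord0) + (sval s ord_max - k) by lia.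
by rewrite iotaD; congr (_ ++ iota _ _); lia.
Qed.

End Embeddable.

Lemma triangulation_chords n (T : triangulation n) :
  exists2 P, triangulating n P & triangles T = triangles_of (chord_set n P).
Proof.
have n2 := triangulation_polygon T; have [D maxD ->] := triangulationP T.
exists (chords_of D); first exact: triangulating_chords_of.
congr triangles_of; apply/setP => c; apply/idP/chord_setP => [cD | [i [j [h ->]]]].
  have [/andP[/forall_inP D2 _] _] := maxsetP maxD.
  have [i [j [ij e]]] := chord_pair (eqP (D2 _ cD)); subst c.
  by exists i, j; split=> //; apply: mem_chords_of.
by have [i' [j' [/val_inj-> /val_inj-> _]]] := chords_ofP h.
Qed.

Definition representable (n : nat) : symset :=
  @SymSet (fun m => 'I_m.+1 -> 'I_n.+1) (fun l m a f i => f (a i))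
    (fun m f => erefl) (fun k l m a b f => erefl).

Definition cell_map (X : symset) n (x : X n) : hom (representable n) X :=
  @Hom (representable n) X (fun m f => act f x) (fun l m a f => act_comp a f x).

(** Cells are maps from representables, by Yoneda. *)
Lemma monomorphism_inj (X Y : symset) (f : hom X Y) : monomorphism f ->
  forall n, injective (@happ _ _ f n).
Proof.
move=> mono n x y xy.
have /mono/(f_equal (fun t : hom (representable n) X => t n id)) :
    hcomp f (cell_map x) = hcomp f (cell_map y).
  by apply: hom_ext => m a; rewrite /= !hnat xy.
by rewrite /= !act_id.
Qed.

Lemma consecutive_spine n (s : 'I_2 -> 'I_n.+1) :
  s ord_max = (s ord0).+1 :> nat -> in_some (spine_sets n) s.
Proof.
move=> e; have ln : s ord0 < n by have := ltn_ord (s ord_max); lia.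
apply/exists_inP; exists [set widen_ord (leqnSn n) (Ordinal ln); lift ord0 (Ordinal ln)].
  exact: imset_f.
apply/forallP => -[[|[|//]] lt]; rewrite !inE -!val_eqE /= /bump /= add1n.
  by rewrite (_ : Ordinal lt = ord0) ?eqxx //; apply: val_inj.
by rewrite (_ : Ordinal lt = ord_max) -?e ?eqxx ?orbT //; apply: val_inj.
Qed.

Section EmbeddableOrthogonal.
Variable X : partial_groupoid.
Hypothesis embX : embeddable X.
Let spX : spiny X := @pg_spiny X.

(** In [tau X] both images of the long side equal the composite of the images of
    the spine, on which the two maps agree, and [X] embeds in the nerve of
    [tau X]. *)
Lemma long_edge_eq n (T T' : triangulation n) (k : hom (H_tri T) X) (k' : hom (H_tri T') X) :
  hcomp k (Sp_H T) = hcomp k' (Sp_H T') ->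
  forall s : cSp n 1, sval s ord0 = ord0 -> sval s ord_max = ord_max ->
  k 1 (cSp_H T 1 s) = k' 1 (cSp_H T' 1 s).
Proof.
move=> kk s s0 s1.
have kkE m (z : Sp n m) : k m (Sp_H T m z) = k' m (Sp_H T' m z).
  exact: (f_equal (fun t : hom (Sp n) X => t m z) kk).
have [P pP eT] := triangulation_chords T; have [P' pP' eT'] := triangulation_chords T'.
have ex (i : nat) : exists x, forall z : Sp n 1,
    sval z ord0 = i :> nat -> sval z ord_max = i.+1 :> nat -> k 1 (Sp_H T 1 z) = x.
  case: (pselect (exists z : Sp n 1, sval z ord0 = i :> nat /\ sval z ord_max = i.+1 :> nat)).
    move=> [z [z0 z1]]; exists (k 1 (Sp_H T 1 z)) => z' z0' z1'.
    congr (k 1 (Sp_H T 1 _)); apply: carried_inj; apply/funext => j; apply: val_inj.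
    have [-> | ->] : j = ord0 \/ j = ord_max.
      by case: j => [[|[|//]] lt]; [left | right]; apply: val_inj.
      by rewrite /= z0 z0'.
    by rewrite /= z1 z1'.
  by move=> nz; exists (k 1 (cSp_H T 1 s)) => z z0 z1; case: nz; exists z.
have [sp spE] := choice ex.
have src_eq : src (k 1 (cSp_H T 1 s)) = src (k' 1 (cSp_H T' 1 s)).
  rewrite /vertex -!hnat.
  have [c cS c0] := spine_const T (sval s ord0).
  have p : in_some (spine_sets n) (fun _ : 'I_1 => sval s ord0).
    by apply/exists_inP; exists c => //; apply/forallP.
  have := kkE 0 (exist (fun f => in_some (spine_sets n) f) _ p).
  by congr (k 0 _ = k' 0 _); apply: carried_inj.
apply: (monomorphism_inj embX); apply: extend_inj => //.
rewrite (extend_chord pP eT (sp := sp)); first last.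
- by rewrite /= s0 s1; exact: chord_root.
- move=> z z1; have p := consecutive_spine z1.
  rewrite -(spE _ (exist (fun f => in_some (spine_sets n) f) _ p)) //.
  by congr (k 1 _); apply: carried_inj.
rewrite (extend_chord pP' eT' (sp := sp)) //.
- move=> z z1; have p := consecutive_spine z1.
  rewrite -(spE _ (exist (fun f => in_some (spine_sets n) f) _ p)) // kkE.
  by congr (k' 1 _); apply: carried_inj.
- by rewrite /= s0 s1; exact: chord_root.
Qed.

Lemma embeddable_orthogonal n (T T' : triangulation n) (wb : well_behaved T T') :
  @orthogonal X (NA_pg wb) (A_pg wb) (NA_to_A T T').
Proof.
move=> g.
pose k : hom (H_tri T) X := hcomp (g : hom (NA_symset T T') X) (po_inl (Sp_H T) (Sp_H T')).
pose k' : hom (H_tri T') X := hcomp (g : hom (NA_symset T T') X) (po_inr (Sp_H T) (Sp_H T')).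
have kk : hcomp k (Sp_H T) = hcomp k' (Sp_H T').
  apply: hom_ext => m z; congr (g m _).
  exact: (f_equal (fun t : hom (Sp n) (NA_symset T T') => t m z) (po_comm (Sp_H T) (Sp_H T'))).
have kkE m (z : cSp n m) : in_some (spine_sets n) (sval z) ->
    k m (cSp_H T m z) = k' m (cSp_H T' m z).
  move=> p; have := f_equal (fun t : hom (Sp n) X =>
    t m (exist (fun f => in_some (spine_sets n) f) _ p)) kk.
  by congr (k m _ = k' m _); apply: carried_inj.
have edgeE (z : cSp n 1) : k 1 (cSp_H T 1 z) = k' 1 (cSp_H T' 1 z).
  have /exists_inP[c] := svalP z; rewrite !inE => /orP[/eqP-> | cS] /forallP zc; last first.
    by apply: kkE; apply/exists_inP; exists c => //; apply/forallP.
  have [e0 e1] := (zc ord0, zc ord_max).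
  have const v : sval z ord0 = v -> sval z ord_max = v -> k 1 (cSp_H T 1 z) = k' 1 (cSp_H T' 1 z).
    move=> z0 z1; have [c' cS vc] := spine_const T v.
    apply: kkE; apply/exists_inP; exists c' => //; apply/forallP => j.
    have [-> | ->] : j = ord0 \/ j = ord_max.
      by case: j => [[|[|//]] lt]; [left | right]; apply: val_inj.
      by rewrite z0.
    by rewrite z1.
  move: e0 e1; rewrite !inE => /orP[]/eqP z0 /orP[]/eqP z1.
  - exact: const z0 z1.
  - exact: long_edge_eq kk _ z0 z1.
  - have hom_inv (Y : symset) (h : hom (cSp n) Y) : h 1 z = inv_edge (h 1 (inv_edge z)).
      by rewrite -{1}[z]inv_edgeK /inv_edge /edge hnat.
    rewrite -[LHS]/(hcomp k (cSp_H T) 1 z) -[RHS]/(hcomp k' (cSp_H T') 1 z).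
    rewrite !hom_inv; congr inv_edge.
    exact: (long_edge_eq kk (s := inv_edge z) z1 z0).
  - exact: const z0 z1.
have kc : hcomp k (cSp_H T) = hcomp k' (cSp_H T').
  apply: hom_ext => m z; apply: cell_ext => // i j.
  by rewrite /edge -!hnat; exact: edgeE.
exists (po_desc kc : hom (A_pg wb) X); split.
  apply: hom_ext => m x; rewrite -[x]repK; move: (rep x) => u.
  transitivity (po_desc kc m (NA_to_A T T' m (class _ u))); last by [].
  by rewrite NA_to_A_class [RHS](po_desc_cellE kc); case: u.
move=> h gh; apply: hom_ext => m x; rewrite -[x]repK; move: (rep x) => u.
transitivity (h m (NA_to_A T T' m (class _ u))); last by rewrite NA_to_A_class.
rewrite [LHS](po_desc_cellE kc) -[RHS]/(hcomp h (NA_to_A T T') m (class _ u)) -gh.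
by case: u.
Qed.

End EmbeddableOrthogonal.

Theorem proposition17 (X : partial_groupoid) :
  embeddable X <->
  forall (n : nat) (T T' : triangulation n) (wb : well_behaved T T'),
    @orthogonal X (NA_pg wb) (A_pg wb) (NA_to_A T T').
Proof.
split=> [embX n T T' wb | orthX]; first exact: embeddable_orthogonal.
exact: orthogonal_embeddable.
Qed.
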